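(* Let $C>0$. Suppose that $\{(X_i,d_i,\nu_i)\}_{i=1}^\infty$ is a sequence of compact measured length spaces that converges to a compact measured length space $(X,d,\nu)$ in the measured Gromov-Hausdorff topology. Suppose that each ball $B$ in $X$ satisfies $\nu[B]=\nu[\overline{B}]$. If each $(X_i,d_i,\nu_i)$ satisfies $\mathrm{DM}(C)$, then so does $(X,d,\nu)$.
   Context: A compact measured length space $(X,d,\nu)$ is a compact length space $(X,d)$ equipped with a Borel probability measure $\nu$. Balls are $B_r(x)=\{y\in X: d(x,y)<r\}$. $\Gamma=\Gamma(X)$ is the set of minimizing constant-speed geodesics $\gamma:[0,1]\to X$ (with the uniform topology), $e_t:\Gamma\to X$, $e_t(\gamma)=\gamma(t)$, and $E=(e_0,e_1):\Gamma\to X\times X$. For $\mu\in P(X)$ (Borel probability measures on $X$), a dynamical democratic transference plan from $\mu$ to itself is a probability measure $\Pi\in P(\Gamma)$ with $E_*\Pi=\mu\otimes\mu$. Given $C>0$, $(X,d,\nu)$ satisfies $\mathrm{DM}(C)$ if for each ball $B=B_r(x)\subset X$ with $\nu[B]>0$ there is a dynamical democratic transference plan $\Pi$ from $\mu=\frac{1_B}{\nu[B]}\nu$ to itself such that, with $\mu_t=(e_t)_*\Pi$, one has the inequality of measures $\int_0^1\mu_t\,dt\le \frac{C}{\nu[B]}\,\nu$. Measured Gromov-Hausdorff convergence of $(X_i,d_i,\nu_i)$ to $(X,d,\nu)$: there are Borel maps $f_i:X_i\to X$ and positive numbers $\epsilon_i\to0$ such that (1) for all $x_i,x_i'\in X_i$,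 $|d(f_i(x_i),f_i(x_i'))-d_i(x_i,x_i')|\le\epsilon_i$; (2) for all $x\in X$ and all $i$ there is $x_i\in X_i$ with $d(f_i(x_i),x)\le\epsilon_i$; and (3) $\lim_{i\to\infty}(f_i)_*\nu_i=\nu$ in the weak-$*$ topology on $P(X)$. *)

(* Defs.v *)
From HB Require Import structures.
From mathcomp Require Import all_boot all_order all_algebra.
From mathcomp Require Import all_classical all_reals all_analysis.

Set Implicit Arguments.
Unset Strict Implicit.
Unset Printing Implicit Defensive.

Import Order.TTheory GRing.Theory Num.Theory.
Import numFieldNormedType.Exports.

Local Open Scope classical_set_scope.
Local Open Scope ring_scope.

(* Measurable types are pointed in the library.  A base point costs nothing
   here: a space carrying a probability measure is nonempty. *)
#[short(type="pmetricType")]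
HB.structure Definition PointedMetric (R : numDomainType) :=
  {T of PseudoPointedMetric R T & Metric R T}.

Notation borel T := (g_sigma_algebraType (@open T)).

Section length_space.
Context {R : realType} (X : metricType R).

(* Metric-valued analogue of variation 0 1 f s. *)
Definition polygonal_length (f : R -> X) (s : seq R) : R :=
  let F := f \o nth 1 (0 :: s) in
  \sum_(0 <= n < size s) mdist (F n) (F n.+1).

Definition curve_length (f : R -> X) : \bar R :=
  ereal_sup [set (polygonal_length f s)%:E | s in itv_partition 0 1].

Definition curves (x y : X) : set (R -> X) :=
  [set f : R -> X | {within `[0, 1], continuous f} /\ f 0 = x /\ f 1 = y].

Definition length_space : Prop :=
  forall x y : X, (mdist x y)%:E = ereal_inf (curve_length @` curves x y).

Definition compact_length_space : Prop := compact [set: X] /\ length_space.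

End length_space.

Section geodesics.
Context {R : realType} (X : pmetricType R).

(* A map [0, 1] -> X is represented by its unique extension to R that is
   constant on each side of [0, 1]. *)
Definition geodesics : set {uniform` `[0, 1] -> X} :=
  [set g : R -> X |
    (forall s t : R, s \in `[0, 1] -> t \in `[0, 1] ->
       mdist (g s) (g t) = `|s - t| * mdist (g 0) (g 1)) /\
    (forall t : R, t <= 0 -> g t = g 0) /\ (forall t : R, 1 <= t -> g t = g 1)].

Definition geodesic : Type := set_type geodesics.

HB.instance Definition _ := Topological.on geodesic.

Lemma geodesics_cst (x : X) : geodesics (fun=> x).
Proof. by split=> // s t _ _; rewrite mdistxx mulr0. Qed.

HB.instance Definition _ := isPointed.Build geodesic
  (SigSub (mem_set (geodesics_cst point))).

Definition eval_at (t : R) (g : borel geodesic) : borel X :=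
  (set_val g : R -> X) t.

Definition endpoints (g : borel geodesic) : borel X * borel X :=
  (eval_at 0 g, eval_at 1 g).

End geodesics.

Lemma measurable_mball {R : realType} (X : pmetricType R) (x : X) (r : R) :
  measurable (ball x r : set (borel X)).
Proof.
apply: sub_sigma_algebra; rewrite /= openE => y.
rewrite ballEmdist/= => xy; apply/nbhs_ballP; exists (r - mdist x y).
  by rewrite /= subr_gt0.
move=> z; rewrite !ballEmdist/= => yz.
by rewrite (le_lt_trans (metric_triangle x y z))// -ltrBrDl.
Qed.

Section democratic.
Context {R : realType} (X : pmetricType R).
Local Open Scope ereal_scope.

(* 1_B nu / nu[B] with B = ball x r; the second argument of mnormalize only
   matters when nu[B] = 0. *)
Definition normalized_ball (nu : probability (borel X) R) (x : X) (r : R) :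
    probability (borel X) R :=
  mnormalize (mrestr nu (measurable_mball x r)) nu.

Definition dynamical_democratic_plan (mu : probability (borel X) R)
    (Pi : probability (borel (geodesic X)) R) : Prop :=
  forall A : set (borel X * borel X), measurable A ->
    pushforward Pi (@endpoints R X) A = (mu \x mu) A.

Definition DM (C : R) (nu : probability (borel X) R) : Prop :=
  forall (x : X) (r : R), (0 < r)%R -> 0 < nu (ball x r) ->
  exists Pi : probability (borel (geodesic X)) R,
    dynamical_democratic_plan (normalized_ball nu x r) Pi /\
    forall A : set (borel X), measurable A ->
      \int[lebesgue_measure]_(t in `[0%R, 1%R])
         pushforward Pi (@eval_at R X t) A
      <= (C / fine (nu (ball x r)))%:E * nu A.

(* Only used on compact X, where every continuous function is bounded. *)
Definition weak_star_cvg (mu_ : nat -> probability (borel X) R)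
    (mu : probability (borel X) R) : Prop :=
  forall h : X -> R, continuous h ->
    \int[mu_ i]_x (h x)%:E @[i --> \oo] --> \int[mu]_x (h x)%:E.

End democratic.

Definition mGH_cvg {R : realType} (X_ : nat -> pmetricType R)
    (nu_ : forall i, probability (borel (X_ i)) R)
    (X : pmetricType R) (nu : probability (borel X) R) : Prop :=
  exists (f : forall i, {mfun borel (X_ i) >-> borel X}) (eps : nat -> R),
  [/\ (forall i, 0 < eps i) /\ eps i @[i --> \oo] --> 0,
      forall i (x x' : X_ i),
        `|mdist (f i x : X) (f i x' : X) - mdist x x'| <= eps i,
      forall (x : X) i, exists xi : X_ i, mdist (f i xi : X) x <= eps i &
      weak_star_cvg (fun i => distribution (nu_ i) (f i)) nu].

(* Main.v *)
Require Import Defs.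
From HB Require Import structures.
From mathcomp Require Import all_boot all_order all_algebra.
From mathcomp Require Import all_classical all_reals all_analysis.
From mathcomp Require Import measurable_realfun ring lra.

Import Order.TTheory GRing.Theory Num.Theory.
Import numFieldNormedType.Exports.

Local Open Scope classical_set_scope.
Local Open Scope ring_scope.

Set Implicit Arguments.
Unset Strict Implicit.
Unset Printing Implicit Defensive.

(** Fix a ball B = B_r(x) of X with nu[B] > 0 and points x_i of X_i with
f_i(x_i) close to x. The closed ball of radius r lies in the closure of B
because X is a length space, so the sphere of radius r is nu-null and the
balls B_r(x_i) have masses converging to nu[B]; from some index on, DM(C)
provides plans Pi_i for them. The plan for B is a limit of the Pi_i, obtained
in two steps.

- On the product of the spaces Gamma(X_i), with an ultrafilter U on the
  indices finer than the Frechet filter, call internal a set of the form {w |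
  w_i in A_i for U-almost all i}. The Loeb measure L is the extension to a
  sigma-algebra of the ultralimit of the Pi_i(A_i). Only one bound on it is
  ever used: L(S) <= a if S lies in the internal set of A and Pi_i(A_i) <= a
  for U-almost all i (loeb_probability).

- For a sequence w of geodesics, the U-limits of the points f_i(w_i(t)) exist
  by compactness of X and form a geodesic of X, the standard part of w. This
  map is measurable: the Borel sets of Gamma(X) are generated by the
  evaluations at the times of [0, 1], and the standard part lies in a closed
  set K at time t exactly when, for each n, f_i(w_i(t)) is 1/n-close to K for
  U-almost all i. The limit plan is the image of L under the standard part.

Both properties of the limit plan follow from upper bounds on closed sets and
from the lower bound on the masses of the balls B_r(x_i).

If K1 and K2 are closed, the event that the endpoints lie in K1 and K2 is
covered by internal sets of asymptotic mass at most mu(K1) mu(K2), where mu =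
1_B nu/nu[B], because the Pi_i are plans and the portmanteau inequality
controls thickenings of K1 and K2. Inner regularity extends this bound to
Borel rectangles, and an upper bound on rectangles between probability
measures forces equality: the complementary pieces of a rectangle have total
mass 1 on both sides.

If K is closed, the probability that the limit geodesic is in K at time t is
at most, up to a small error, the Pi_i-probability that f_i(w_i(t)) is near K,
and this for one i and all t in [0, 1] at once, because geodesics of bounded
length are equi-Lipschitz and it suffices to look at finitely many times. This
uniformity is what allows integrating in t, since Fatou's lemma fails along
ultrafilters. Applying DM(C) on X_i gives the bound for closed sets; monotone
convergence gives it for open sets, and outer regularity of nu for Borel sets. *)

(** * Loeb measure of an ultraproduct of probability spaces *)

Section loeb.
Context {R : realType} (d : nat -> measure_display)
  (T : forall i, measurableType (d i)) (P : forall i, probability (T i) R)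
  (U : set_system nat).
Local Open Scope ereal_scope.

(** The preimage, in the product, of an internal subset of the ultraproduct
along U. Working in the product itself avoids the quotient. *)
Definition internal (A : forall i, set (T i)) : set (forall i, T i) :=
  [set w | \forall i \near U, A i (w i)].

(** Asking for the bound at every index, instead of U-almost every one, gives
the same value by [loeb_outer_le] and lets covers be united index by index. *)
Definition loeb_outer (S : set (forall i, T i)) : \bar R :=
  ereal_inf [set c | exists A : forall i, set (T i),
    [/\ forall i, measurable (A i), S `<=` internal A &
        forall i, P i (A i) <= c]].

Lemma loeb_outer_ge0 S : 0 <= loeb_outer S.
Proof. by apply: le_ereal_inf_tmp => c [A [mA _ /(_ 0%N)]]; exact: le_trans. Qed.

Hypothesis FU : ProperFilter U.

Lemma loeb_outer_le S (A : forall i, set (T i)) c :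
    (forall i, measurable (A i)) -> S `<=` internal A ->
    (\forall i \near U, P i (A i) <= c) ->
  loeb_outer S <= c.
Proof.
move=> mA SA PAc; have c0 : 0 <= c.
  by have [i] := filter_ex PAc; apply: le_trans.
apply: ereal_inf_lbound.
(* emptying A at the exceptional indices does not change its internal set *)
exists (fun i => if `[< P i (A i) <= c >] then A i else set0); split.
- by move=> i; case: ifP.
- move=> w /SA Aw; apply: filterS2 PAc Aw => i Pc Aw.
  by move/asboolP: Pc => ->.
- by move=> i; case: ifPn => [/asboolP//|_]; rewrite measure0.
Qed.

(** A cover of the whole product has some full component: otherwise a sequence
of missed points would escape it. *)
Lemma loeb_outer_setT : loeb_outer setT = 1.
Proof.
apply/eqP; rewrite eq_le; apply/andP; split.
  apply: (@loeb_outer_le _ (fun=> setT)) => //.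
    by move=> w _; exact: filterE.
  by apply: filterE => i; rewrite probability_setT.
apply: le_ereal_inf_tmp => c [A [mA TA Ac]].
have [i Ai] : exists i, A i = setT.
  apply: contrapT => /forallNP h.
  have h' i : exists x, ~ A i x.
    by apply/existsNP => Ai; apply: (h i); rewrite -subTset => x _.
  have : internal A (fun i => projT1 (cid (h' i))) by exact: TA.
  by move=> /filter_ex[i]; exact: (projT2 (cid (h' i))).
by rewrite -(probability_setT (P i)) -Ai.
Qed.

Lemma loeb_outer0 : loeb_outer set0 = 0.
Proof.
apply/eqP; rewrite eq_le loeb_outer_ge0 andbT.
apply: (@loeb_outer_le _ (fun=> set0)) => //.
by apply: filterE => i; rewrite measure0.
Qed.

Lemma le_loeb_outer : {homo loeb_outer : A B / A `<=` B >-> A <= B}.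
Proof.
move=> S S' SS'; apply: le_ereal_inf => c [A [mA SA Ac]]; exists A.
by split => //; exact: subset_trans SA.
Qed.

Lemma loeb_outer_fin_num S : loeb_outer S \is a fin_num.
Proof.
rewrite ge0_fin_numE ?loeb_outer_ge0//.
by rewrite (@le_lt_trans _ _ 1) ?ltry// -loeb_outer_setT le_loeb_outer.
Qed.

Lemma loeb_outer_sigma_subadditive : sigma_subadditive loeb_outer.
Proof.
move=> F; apply/lee_addgt0Pr => e e0.
rewrite (le_trans _ (epsilon_trick _ _ (ltW e0)))//; last first.
  by move=> n; exact: loeb_outer_ge0.
have /choice[A hA] n : exists A : forall i, set (T i),
    [/\ forall i, measurable (A i), F n `<=` internal A &
      forall i, P i (A i) <= loeb_outer (F n) + (e / (2 ^ n.+1)%:R)%:E].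
  have e2 : (0 < e / (2 ^ n.+1)%:R)%R by rewrite divr_gt0 ?ltr0n ?expn_gt0.
  have [c [A [mA FA Ac]] cF] :=
    lb_ereal_inf_adherent e2 (loeb_outer_fin_num (F n)).
  by exists A; split => // i; rewrite (le_trans (Ac i)) 1?ltW.
apply: (@loeb_outer_le _ (fun i => \bigcup_n A n i)) => //.
- by move=> i; apply: bigcup_measurable => n _; have [] := hA n.
- move=> w [n _ Fw]; have [_ /(_ _ Fw) Aw _] := hA n.
  by apply: filterS Aw => i; exists n.
- apply: filterE => i; apply: le_trans.
    (* the bounds on the covers of the F n hold at every index, so the union
       of these covers may be taken index by index *)
    apply: (@measure_sigma_subadditive _ _ _ (P i) (\bigcup_n A n i)
      (fun n => A n i)) => //.
      by move=> n; have [] := hA n.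
    by apply: bigcup_measurable => n _; have [] := hA n.
  apply: lee_nneseries => [n _ _|n _]; first exact: measure_ge0.
  by have [_ _ /(_ i)] := hA n.
Qed.

End loeb.

Section loeb_measure.
Context {R : realType} (d : nat -> measure_display)
  (T : forall i, measurableType (d i)) (P : forall i, probability (T i) R)
  (U : set_system nat) (FU : UltraFilter U).
Local Open Scope ereal_scope.

Lemma near_ultraNP (Q : nat -> Prop) :
  ~ (\forall i \near U, Q i) -> \forall i \near U, ~ Q i.
Proof. by have [] := in_ultra_setVsetC Q FU. Qed.

(** The outer measure structure needs the hypothesis that U is proper, so it
is packed by hand rather than declared on [loeb_outer]. *)
Definition loeb : outer_measure R (forall i, T i) :=
  HB.pack (loeb_outer P U) (@isOuterMeasure.Build R _ (loeb_outer P U)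
    (loeb_outer0 P _) (loeb_outer_ge0 P U)
    (@le_loeb_outer _ _ _ P U) (loeb_outer_sigma_subadditive P _)).

(** This is where U has to be an ultrafilter: the complement of an internal
set must be internal. *)
Lemma internal_caratheodory (B : forall i, set (T i)) :
  (forall i, measurable (B i)) -> caratheodory_measurable loeb (internal U B).
Proof.
move=> mB; apply: le_caratheodory_measurable => X /=.
apply: le_ereal_inf_tmp => c [A [mA XA Ac]].
have c0 : 0 <= c := le_trans (measure_ge0 _ _) (Ac 0%N).
case: c c0 Ac => [c||] c0 Ac; [|by rewrite leey|by []].
set x := loeb_outer P U _; set y := loeb_outer P U _.
have xfin : x \is a fin_num by exact: loeb_outer_fin_num.
apply/lee_addgt0Pr => e e0; rewrite -(fineK xfin) addeC -leeBrDr//.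
have mAB i : measurable (A i `&` B i) by exact: measurableI.
(* x is an infimum, so the part of the cover inside B has mass above x - e
   along U, and what remains for the part outside is at most c - x + e *)
have : ~ \forall i \near U, P i (A i `&` B i) <= (fine x - e)%:E.
  move=> /(@loeb_outer_le _ _ _ P U _ (X `&` internal U B) _ _ mAB) => /(_ _) h.
  have : x <= (fine x - e)%:E.
    by apply: h => w [/XA Aw Bw]; exact: filterI Aw Bw.
  by rewrite -{1}(fineK xfin) lee_fin; lra.
move/near_ultraNP => PAB.
apply: (@loeb_outer_le _ _ _ P U _ _ (fun i => A i `\` B i)) => //.
- by move=> i; exact: measurableD.
- move=> w [/XA Aw nBw].
  by have [//|] := in_ultra_setVsetC [set i | B i (w i)] FU; exact: filterI.
- apply: filterS PAB => i /negP; rewrite -ltNge => PAB.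
  have fAB : P i (A i `&` B i) \is a fin_num by rewrite fin_num_measure.
  have fADB : P i (A i `\` B i) \is a fin_num.
    by rewrite fin_num_measure//; exact: measurableD.
  have : P i (A i `\` B i) + P i (A i `&` B i) <= c%:E.
    by rewrite -(measureDI _ (mA i) (mB i)); exact: Ac.
  move: PAB; rewrite -(fineK fAB) -(fineK fADB) -!EFinD lte_fin !lee_fin.
  by move=> ? ?; lra.
Qed.

(** All that is needed about the Loeb measure: internal sets are measurable,
and the mass of a subset of an internal set is bounded by the asymptotic
bounds of its components. *)
Lemma loeb_probability : exists (disp : measure_display)
    (M : measurableType disp) (L : probability M R) (w : M -> forall i, T i),
  (forall A : forall i, set (T i), (forall i, measurable (A i)) ->
     measurable (w @^-1` internal U A)) /\
  (forall (S : set M) (A : forall i, set (T i)) c, measurable S ->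
     (forall i, measurable (A i)) -> S `<=` w @^-1` internal U A ->
     (\forall i \near U, P i (A i) <= c) -> L S <= c).
Proof.
pose M : measurableType _ := caratheodory_type loeb.
pose m : {measure set M -> \bar R} := (loeb : set M -> \bar R).
have m1 : m setT = 1 by exact: loeb_outer_setT.
pose L : probability M R := HB.pack (m : set M -> \bar R) m
  (@Measure_isProbability.Build _ _ _ m m1).
exists _, M, L, id; split => [A|S A c _]; first exact: internal_caratheodory.
exact: loeb_outer_le.
Qed.

End loeb_measure.

(** * Borel probability measures on metric spaces *)

Section borel_sets.
Context {R : realType} (X : pmetricType R).
Implicit Types (A K O : set X) (x y z : X) (r s : R).

Lemma open_mball x r : open (ball x r).
Proof.
rewrite openE => y; rewrite ballEmdist/= => xy.
apply/nbhs_ballP; exists (r - mdist x y); first by rewrite /= subr_gt0.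
move=> z; rewrite !ballEmdist/= => yz.
by rewrite (le_lt_trans (metric_triangle x y z))// -ltrBrDl.
Qed.

Lemma measurable_open_borel O : open O -> measurable (O : set (borel X)).
Proof. exact: sub_sigma_algebra. Qed.

Lemma measurable_closed_borel K : closed K -> measurable (K : set (borel X)).
Proof.
move=> cK; rewrite -[K]setCK; apply: measurableC.
by apply: measurable_open_borel; exact: closed_openC.
Qed.

Lemma ex_invS_lt r : 0 < r -> exists n, n.+1%:R^-1 < r.
Proof.
move=> r0; have [n _ h] := near_infty_natSinv_lt (PosNum r0).
by exists n; exact: (h n (leqnn n)).
Qed.

Definition thickening K r : set X := [set y | exists2 z, K z & mdist z y < r].

Lemma open_thickening K r : open (thickening K r).
Proof.
have -> : thickening K r = \bigcup_(z in K) ball z r.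
  apply/seteqP; split=> y [z Kz].
    by exists z; rewrite // ballEmdist.
  by rewrite ballEmdist; exists z.
by apply: bigcup_open => z _; exact: open_mball.
Qed.

Lemma sub_thickening K r : 0 < r -> K `<=` thickening K r.
Proof. by move=> r0 x Kx; exists x; rewrite // mdistxx. Qed.

Lemma thickeningS K r s : r <= s -> thickening K r `<=` thickening K s.
Proof. by move=> rs y [z Kz zy]; exists z => //; exact: lt_le_trans rs. Qed.

Lemma thickening_triangle K r s x y :
  thickening K r x -> mdist x y <= s -> thickening K (r + s) y.
Proof.
move=> [z Kz zx] xy; exists z => //.
by rewrite (le_lt_trans (metric_triangle z x y))// ltr_leD.
Qed.

Lemma closure_thickening K r s :
  r < s -> closure (thickening K r) `<=` thickening K s.
Proof.
move=> rs y /(_ (ball y (s - r))) []; first by apply: nbhsx_ballx; rewrite subr_gt0.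
move=> x [Kx]; rewrite ballEmdist/= metric_sym => /ltW xy.
by rewrite -(subrKC r s); exact: thickening_triangle Kx xy.
Qed.

Lemma bigcap_thickening K : closed K ->
  \bigcap_n thickening K n.+1%:R^-1 = K.
Proof.
move=> cK; apply/seteqP; split=> [x Kx|x Kx n _]; last exact: sub_thickening.
rewrite (closure_id K).1// => B /nbhs_ballP[e /= e0 eB].
have [n ne] := ex_invS_lt e0; have [z Kz zx] := Kx n I.
exists z; split => //; apply: eB; rewrite ballEmdist/= metric_sym.
exact: lt_trans ne.
Qed.

Lemma thickening_decr K (m n : nat) : (m <= n)%N ->
  thickening K n.+1%:R^-1 `<=` thickening K m.+1%:R^-1.
Proof. by move=> mn; apply: thickeningS; rewrite lef_pV2 ?posrE// ler_nat. Qed.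

End borel_sets.

Section prob.
Context {R : realType} d (T : measurableType d) (P : probability T R).
Local Open Scope ereal_scope.

(** Continuity from above, in the form used to choose the size of a
thickening. *)
Lemma probability_decr_le (F : (set T)^nat) (Q : set T) (e : R) :
    (forall n, measurable (F n)) -> measurable Q -> nonincreasing_seq F ->
    \bigcap_n F n `<=` Q -> (0 < e)%R ->
  exists n, P (F n) <= P Q + e%:E.
Proof.
move=> mF mQ dF FQ e0.
have mI : measurable (\bigcap_n F n) by exact: bigcap_measurable.
have /fine_cvgP[_ /cvgrPdist_lt /(_ e e0)[n _ /(_ n (leqnn n))/=]] :
    P \o F @ \oo --> (fine (P (\bigcap_n F n)))%:E.
  rewrite fineK ?fin_num_measure//; apply: nonincreasing_cvg_mu => //.
  by rewrite (le_lt_trans (probability_le1 _ _)) ?ltry.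
rewrite ltr_norml => /andP[h _]; exists n.
have : P (\bigcap_n F n) <= P Q by apply: le_measure; rewrite ?inE.
have f1 : P (\bigcap_n F n) \is a fin_num by rewrite fin_num_measure.
have f2 : P (F n) \is a fin_num by rewrite fin_num_measure.
have f3 : P Q \is a fin_num by rewrite fin_num_measure.
rewrite -(fineK f1) -(fineK f2) -(fineK f3) -EFinD !lee_fin => h1.
by move: h h1 => /= h h1; lra.
Qed.

End prob.

Section regularity.
Context {R : realType} (X : pmetricType R) (P : probability (borel X) R).
Local Open Scope ereal_scope.

Let regular : set (set X) := [set A | forall e : R, (0 < e)%R ->
  exists F O, [/\ closed F, open O, F `<=` A, A `<=` O & P (O `\` F) <= e%:E]].

Let regular_open (O : set X) : open O -> regular O.
Proof.
move=> oO e e0.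
have cO : closed (~` O) by exact: open_closedC.
pose G n := O `&` thickening (~` O) n.+1%:R^-1.
have oG n : open (G n) by apply: openI => //; exact: open_thickening.
have dG : nonincreasing_seq G.
  by move=> m n mn; apply/subsetPset; apply: setIS; exact: thickening_decr.
have IG : \bigcap_n G n `<=` set0.
  move=> x Gx.
  have : (\bigcap_n thickening (~` O) n.+1%:R^-1) x by move=> n _; have [] := Gx n I.
  by rewrite bigcap_thickening// => nOx; have [Ox _] := Gx 0%N I.
have [n] := probability_decr_le P (fun n => measurable_open_borel (oG n))
  measurable0 dG IG e0.
rewrite measure0 add0e => Pn.
exists (~` thickening (~` O) n.+1%:R^-1), O; split => //.
- by apply: open_closedC; exact: open_thickening.
- by rewrite -[X in _ `<=` X]setCK; apply: subsetC; exact: sub_thickening.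
- by rewrite setDE setCK.
Qed.

Let regular_bigcup (A : (set X)^nat) :
  (forall n, regular (A n)) -> regular (\bigcup_n A n).
Proof.
move=> rA e e0; have e20 : (0 < e / 2)%R by rewrite divr_gt0.
have /choice[F /all_and5[cF oF FA AF PF]] :
    forall n, exists F : set X * set X,
    [/\ closed F.1, open F.2, F.1 `<=` A n, A n `<=` F.2 &
        P (F.2 `\` F.1) <= (e / 2 / (2 ^ n.+1)%:R)%:E].
  move=> n; have [|F [V h]] := rA n (e / 2 / (2 ^ n.+1)%:R)%R; last by exists (F, V).
  by rewrite divr_gt0// ltr0n expn_gt0.
pose O := \bigcup_n (F n).2.
pose K n := \bigcup_(i in `I_n) (F i).1.
have oO : open O by apply: bigcup_open => n _; exact: oF.
have cK n : closed (K n) by apply: closed_bigcup => // i _; exact: cF.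
have mO : measurable (O : set (borel X)) by exact: measurable_open_borel.
have mF1 n : measurable ((F n).1 : set (borel X)) by exact: measurable_closed_borel.
have mF2 n : measurable ((F n).2 : set (borel X)) by exact: measurable_open_borel.
have mK n : measurable (K n : set (borel X)) by exact: measurable_closed_borel.
have mUF : measurable (\bigcup_n (F n).1 : set (borel X)).
  by apply: bigcup_measurable => n _; exact: mF1.
have mD n : measurable ((F n).2 `\` (F n).1 : set (borel X)) by exact: measurableD.
have dK : nonincreasing_seq (fun n => O `\` K n).
  move=> m n mn; apply/subsetPset => x [Ox nK]; split => // Kx; apply: nK.
  by have [i im Fx] := Kx; exists i => //=; exact: leq_trans mn.
have IK : \bigcap_n (O `\` K n) `<=` O `\` \bigcup_n (F n).1.
  move=> x h; split; first by have [] := h 0%N I.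
  move=> [n _ Fx]; have [_] := h n.+1 I; apply.
  by exists n => /=.
have [n Pn] := probability_decr_le P (fun n => measurableD mO (mK n))
  (measurableD mO mUF) dK IK e20.
exists (K n), O; split => //.
- by apply: bigcup_sub => i _ x /FA; exists i.
- by apply: subset_bigcup => i _; exact: AF.
- rewrite (le_trans Pn)// [in leRHS](splitr e) EFinD leeD2r//.
  apply: (@le_trans _ _ (P (\bigcup_n ((F n).2 `\` (F n).1)))).
    apply: le_measure; rewrite ?inE; [exact: measurableD|exact: bigcupT_measurable|].
    move=> x [[i _ Fx] nF]; exists i => //; split => // Fx1; apply: nF.
    by exists i.
  apply: (le_trans (measure_sigma_subadditive _ mD
    (bigcupT_measurable _ mD) (@subset_refl _ _))).
  apply: le_trans (epsilon_trick0 xpredT (ltW e20)).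
  by apply: lee_nneseries => [i _ _|i _]; [exact: measure_ge0|exact: PF].
Qed.

(** The sets with this property form a sigma-algebra. It contains the open
sets because an open set is the increasing union of the closed sets of points
at distance at least 1/n from its complement. *)
Lemma borel_regular (A : set (borel X)) (e : R) : measurable A -> (0 < e)%R ->
  exists F O : set X,
    [/\ closed F, open O, F `<=` A, A `<=` O & P (O `\` F) <= e%:E].
Proof.
move=> mA; move: e; apply: (_ : regular A).
suff : <<s @open X >> `<=` regular by exact.
apply: smallest_sub; last exact: regular_open.
split.
- move=> e e0; exists set0, set0; split => //; [exact: closed0|exact: open0|].
  by rewrite setDv measure0 lee_fin ltW.
- move=> B rB e /rB[F [V [cF oO FB BO POF]]].
  exists (~` V), (~` F); split.
  + exact: open_closedC.
  + exact: closed_openC.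
  + by rewrite setTD; exact: subsetC.
  + by rewrite setTD; exact: subsetC.
  + by rewrite setDE setCK setIC -setDE.
- exact: regular_bigcup.
Qed.

Lemma borel_inner_regular (A : set (borel X)) (e : R) :
  measurable A -> (0 < e)%R ->
  exists F : set X, [/\ closed F, F `<=` A & P (A `\` F) <= e%:E].
Proof.
move=> mA e0; have [F [V [cF oO FA AO POF]]] := borel_regular mA e0.
exists F; split => //; apply: le_trans POF.
have mF := measurable_closed_borel cF; have mO := measurable_open_borel oO.
apply: le_measure; rewrite ?inE; [exact: measurableD|exact: measurableD|].
exact: setSD.
Qed.

Lemma borel_outer_regular (A : set (borel X)) (e : R) :
  measurable A -> (0 < e)%R ->
  exists O : set X, [/\ open O, A `<=` O & P O <= P A + e%:E].
Proof.
move=> mA e0; have [F [V [cF oO FA AO POF]]] := borel_regular mA e0.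
exists V; split => //.
have mF := measurable_closed_borel cF; have mO := measurable_open_borel oO.
have := measureDI P mO mF; rewrite (setIidr (subset_trans FA AO)) => ->.
rewrite addeC leeD//; apply: le_measure; rewrite ?inE //.
Qed.

End regularity.

Lemma measurable_fun_borel d (T : measurableType d) (Y : ptopologicalType)
    (f : T -> Y) : (forall O : set Y, open O -> measurable (f @^-1` O)) ->
  measurable_fun setT (f : T -> borel Y).
Proof.
move=> mf; apply: (@measurability _ _ _ (borel Y) setT f (@open Y)) => //.
by move=> _ [V oV <-]; rewrite setTI; exact: mf.
Qed.

Lemma continuous_measurable_borel {R : realType} (Y : ptopologicalType)
  (h : Y -> R) : continuous h -> measurable_fun setT (h : borel Y -> R).
Proof.
move=> ch; apply: (measurability _ (RGenOpens.measurableE R)).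
move=> /= _ [_ [a [b ->]] <-]; rewrite setTI.
by apply: sub_sigma_algebra; move/continuousP : ch; apply; exact: interval_open.
Qed.

Section portmanteau.
Context {R : realType} (X : pmetricType R).
Local Open Scope ereal_scope.

(** K and the complement of its r-thickening are separated by the entourage {d
< r}, so Urysohn's construction applies. *)
Lemma thickening_separator (K : set X) (r : R) : (0 < r)%R -> exists h : X -> R,
  [/\ continuous h, forall x, (0 <= h x <= 1)%R, forall x, K x -> h x = 1%R &
      forall x, h x != 0%R -> thickening K r x].
Proof.
move=> r0; have sep : uniform_separator (~` thickening K r) K.
  apply: uniform_separatorW; exists [set xy | ball xy.1 r xy.2].
    exact: entourage_ball (PosNum r0).
  rewrite -subset0 => -[x y] [[/= nKx Ky]]; rewrite ballEmdist/= => xy.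
  by apply: nKx; exists y => //; rewrite metric_sym.
exists (Urysohn (R := R) (~` thickening K r) K); split.
- exact: Urysohn_continuous.
- move=> x; have := @Urysohn_range X R (~` thickening K r) K _
    (ex_intro2 _ _ x I erefl).
  by rewrite /= in_itv.
- by move=> x Kx; apply: (Urysohn_sub1 sep); exists x.
- move=> x; apply: contra_neqP => nKx.
  by apply: (Urysohn_sub0 sep); exists x.
Qed.

(** Squeeze a continuous function between the indicators of K and of a
thickening of K whose mass is close to that of K. *)
Lemma portmanteau_closed (mu_ : nat -> probability (borel X) R)
    (mu : probability (borel X) R) (K : set X) (e : R) :
  weak_star_cvg mu_ mu -> closed K -> (0 < e)%R ->
  \forall i \near \oo, mu_ i K <= mu K + e%:E.
Proof.
move=> cmu cK e0; have e20 : (0 < e / 2)%R by rewrite divr_gt0.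
have mK := measurable_closed_borel cK.
have mKn n := measurable_open_borel (open_thickening K n.+1%:R^-1).
have dK : nonincreasing_seq (fun n => thickening K n.+1%:R^-1).
  by move=> m n mn; apply/subsetPset; exact: thickening_decr.
have [|n Kn] := probability_decr_le mu mKn mK dK _ e20.
  by rewrite bigcap_thickening.
have [h [ch h01 hK hKn]] := @thickening_separator K n.+1%:R^-1 ltac:(by []).
have mh : measurable_fun [set: borel X] (fun x : borel X => (h x)%:E).
  by apply/measurable_EFinP; exact: continuous_measurable_borel.
have h0 x : 0 <= (h x)%:E by rewrite lee_fin; case/andP: (h01 x).
have le_int : \int[mu]_x (h x)%:E <= mu (thickening K n.+1%:R^-1).
  have mKn' := mKn n.
  apply: (@le_trans _ _ (\int[mu]_x (\1_(thickening K n.+1%:R^-1) x)%:E)).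
    apply: ge0_le_integral => //.
      by apply/measurable_EFinP; exact: measurable_indic.
    move=> x _; rewrite lee_fin indicE.
    have [|nx] := boolP (x \in _); first by case/andP: (h01 x).
    have [->//|/hKn] := eqVneq (h x) 0%R.
    by move/mem_set; rewrite (negbTE nx).
  by rewrite integral_indic// setIT.
have int_le i : mu_ i K <= \int[mu_ i]_x (h x)%:E.
  rewrite -[leLHS](_ : \int[mu_ i]_x (\1_K x)%:E = _); last first.
    by rewrite integral_indic// setIT.
  apply: ge0_le_integral => //.
    by apply/measurable_EFinP; exact: measurable_indic.
  move=> x _; rewrite lee_fin indicE.
  have [/set_mem/hK->//|nx] := boolP (x \in _).
  by case/andP: (h01 x).
have fK : mu K \is a fin_num by rewrite fin_num_measure.
have fI : \int[mu]_x (h x)%:E \is a fin_num.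
  rewrite ge0_fin_numE; last exact: integral_ge0.
  by rewrite (le_lt_trans le_int)// (le_lt_trans Kn)// -(fineK fK) ltry.
have := cmu _ ch; rewrite -(fineK fI) => /fine_cvgP[ffin /cvgrPdist_lt /(_ _ e20)].
apply: filterS2 ffin => i fi.
rewrite ltr_norml => /andP[+ _] => h1; rewrite (le_trans (int_le i))//.
move: h1 le_int Kn => /=; rewrite -(fineK fi) -(fineK fI) -(fineK fK).
have fT : mu (thickening K n.+1%:R^-1) \is a fin_num by rewrite fin_num_measure.
by rewrite -(fineK fT) /= -!EFinD !lee_fin => h1 h2 h3; lra.
Qed.

End portmanteau.

(** * Lower integrals, and measures on rectangles *)

Section lower_integral.
Context d (T : measurableType d) {R : realType} (mu : {measure set T -> \bar R}).
Local Open Scope ereal_scope.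

(** The integral of a nonnegative function is the supremum over the simple
functions below it, so monotonicity holds for arbitrary functions. *)
Lemma ge0_le_lower_integral (D : set T) (f g : T -> \bar R) :
  (forall x, D x -> 0 <= f x) -> (forall x, D x -> f x <= g x) ->
  \int[mu]_(x in D) f x <= \int[mu]_(x in D) g x.
Proof.
move=> f0 fg; have g0 x : D x -> 0 <= g x.
  by move=> Dx; exact: le_trans (f0 _ Dx) (fg _ Dx).
rewrite !ge0_integralE//; apply: le_ereal_sup => _ [h hf <-]; exists h => //.
move=> x; apply: (le_trans (hf x)); rewrite /patch.
by case: ifPn => // /set_mem /fg.
Qed.

End lower_integral.

Section rectangles.
Context {R : realType}.
Local Open Scope ereal_scope.

(** The complement of A x B is the disjoint union of A x B^c and A^c x T2, on
which m has mass at most 1 - m1 A * m2 B. *)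
Lemma rectangle_le_eq d1 d2 (T1 : measurableType d1) (T2 : measurableType d2)
    (m : probability (T1 * T2)%type R) (m1 : probability T1 R)
    (m2 : probability T2 R) :
  (forall A B, measurable A -> measurable B -> m (A `*` B) <= m1 A * m2 B) ->
  forall A B, measurable A -> measurable B -> m (A `*` B) = m1 A * m2 B.
Proof.
move=> le_m A B mA mB.
have mAc := measurableC mA; have mBc := measurableC mB.
have mAB := measurableX mA mB; have mABc := measurableX mA mBc.
have mAcT : measurable (~` A `*` [set: T2]) by exact: measurableX.
apply/eqP; rewrite eq_le le_m//=.
have : m setT <= m (A `*` B) + m1 A * m2 (~` B) + m1 (~` A) * m2 setT.
  apply: (@le_trans _ _ (m ((A `*` B `|` A `*` ~` B) `|` ~` A `*` setT))).
    apply: le_measure; rewrite ?inE//.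
      by apply: measurableU => //; exact: measurableU.
    move=> [a b] _; have [Aa|nAa] := pselect (A a); last by right.
    by left; have [Bb|nBb] := pselect (B b); [left|right].
  apply: (le_trans (measureU2 _ _ _)) => //; first exact: measurableU.
  apply: leeD; last exact: le_m.
  by apply: (le_trans (measureU2 _ _ _)) => //; exact: leeD2l (le_m _ _ _ _).
rewrite !probability_setT mule1 !probability_setC//.
have f1 : m (A `*` B) \is a fin_num by rewrite fin_num_measure.
have f2 : m1 A \is a fin_num by rewrite fin_num_measure.
have f3 : m2 B \is a fin_num by rewrite fin_num_measure.
rewrite -(fineK f1) -(fineK f2) -(fineK f3).
rewrite -!EFinB -!EFinM -!EFinD !lee_fin mulrBr mulr1; lra.
Qed.

(** Inner regularity of both marginals of m. *)
Lemma closed_rectangle_le (X : pmetricType R)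
    (m : probability (borel X * borel X)%type R) (mu : probability (borel X) R) :
  (forall K1 K2 : set X, closed K1 -> closed K2 ->
     m (K1 `*` K2) <= mu K1 * mu K2) ->
  forall A B, measurable A -> measurable B -> m (A `*` B) <= mu A * mu B.
Proof.
move=> le_m A B mA mB; apply/lee_addgt0Pr => e e0.
have e20 : (0 < e / 2)%R by rewrite divr_gt0.
pose p1 : {mfun (borel X * borel X)%type >-> borel X} :=
  HB.pack (@fst (borel X) (borel X))
    (isMeasurableFun.Build _ _ _ _ _ measurable_fst).
pose p2 : {mfun (borel X * borel X)%type >-> borel X} :=
  HB.pack (@snd (borel X) (borel X))
    (isMeasurableFun.Build _ _ _ _ _ measurable_snd).
have [K1 [cK1 K1A hK1]] := borel_inner_regular (distribution m p1) mA e20.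
have [K2 [cK2 K2B hK2]] := borel_inner_regular (distribution m p2) mB e20.
have mK1 := measurable_closed_borel cK1; have mK2 := measurable_closed_borel cK2.
have mD1 := measurableD mA mK1; have mD2 := measurableD mB mK2.
have h1 : m ((A `\` K1) `*` setT) <= (e / 2)%:E.
  suff <- : p1 @^-1` (A `\` K1) = (A `\` K1) `*` setT by [].
  by apply/seteqP; split => -[a b] // [].
have h2 : m (setT `*` (B `\` K2)) <= (e / 2)%:E.
  suff <- : p2 @^-1` (B `\` K2) = setT `*` (B `\` K2) by [].
  by apply/seteqP; split => -[a b] // [].
have mKK := measurableX mK1 mK2.
have mDT := measurableX mD1 (@measurableT _ (borel X)).
have mTD := measurableX (@measurableT _ (borel X)) mD2.
have mAB := measurableX mA mB.
apply: (@le_trans _ _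
  (m ((K1 `*` K2 `|` (A `\` K1) `*` setT) `|` setT `*` (B `\` K2)))).
  apply: le_measure; rewrite ?inE//.
    by apply: measurableU => //; exact: measurableU.
  move=> [a b] [/= Aa Bb]; have [K1a|nK1a] := pselect (K1 a); last by left; right.
  by have [K2b|nK2b] := pselect (K2 b); [left; left|right].
apply: (le_trans (measureU2 _ _ _)) => //; first exact: measurableU.
rewrite (splitr e) EFinD addeA; apply: leeD => //.
apply: (le_trans (measureU2 _ _ _)) => //; apply: leeD => //.
apply: (le_trans (le_m _ _ cK1 cK2)).
by apply: lee_pmul => //; apply: le_measure; rewrite ?inE.
Qed.

Lemma normalized_ballE (X : pmetricType R) (nu : probability (borel X) R)
    (x : X) (r : R) (A : set (borel X)) : 0 < nu (ball x r) ->
  normalized_ball nu x r A =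
    nu (A `&` ball x r) * ((fine (nu (ball x r)))^-1)%:E.
Proof.
move=> B0; have mB := measurable_mball x r.
rewrite /normalized_ball /= /mnormalize /= /mrestr setTI.
have -> : (nu (ball x r) == 0) = false by rewrite gt_eqF.
by have -> : (nu (ball x r) == +oo) = false
  by rewrite lt_eqF// (le_lt_trans (probability_le1 _ _)) ?ltry.
Qed.

End rectangles.

(** * The space of geodesics *)

Section geodesic_facts.
Context {R : realType} (X : pmetricType R).
Implicit Types (g : geodesic X) (s t : R).

Lemma eval_at_dist g s t : s \in `[0, 1] -> t \in `[0, 1] ->
  mdist (eval_at s g : X) (eval_at t g) =
  `|s - t| * mdist (eval_at 0 g : X) (eval_at 1 g).
Proof. by move=> s01 t01; have [/(_ _ _ s01 t01)] := set_valP g. Qed.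

Lemma eval_at_le0 g t : t <= 0 -> eval_at t g = eval_at 0 g.
Proof. by have [_ [+ _]] := set_valP g; exact. Qed.

Lemma eval_at_ge1 g t : 1 <= t -> eval_at t g = eval_at 1 g.
Proof. by have [_ [_ +]] := set_valP g; exact. Qed.

Lemma open_eval_at t (V : set X) : t \in `[0, 1] -> open V ->
  open (@eval_at R X t @^-1` V : set (geodesic X)).
Proof.
move=> t01 oV.
pose W := [set h : {uniform` `[0%R, 1%R] -> X} | V ((h : R -> X) t)].
have oW : open W.
  rewrite openE => h Vh; apply/uniform_nbhs.
  have : nbhs ((h : R -> X) t) V by exact: open_nbhs_nbhs.
  rewrite -nbhs_entourageE => -[E entE EV]; exists E; split => // k Ek.
  by apply: EV; apply/xsectionP; apply: Ek; rewrite inE in t01 *.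
by exists W.
Qed.

Lemma measurable_eval_at t : t \in `[0, 1] ->
  measurable_fun setT (@eval_at R X t).
Proof.
move=> t01; apply: measurable_fun_borel => V oV.
by apply: sub_sigma_algebra; exact: open_eval_at.
Qed.

(** The topology of uniform convergence on [0, 1], in terms of the distance. *)
Lemma geodesic_nbhs g (V : set (geodesic X)) : open V -> V g ->
  exists2 e : R, 0 < e & forall g' : geodesic X,
    (forall t, t \in `[0, 1] -> mdist (eval_at t g : X) (eval_at t g') < e) ->
    V g'.
Proof.
move=> [W oW <-] Wg.
have : nbhs (set_val g : {uniform` `[0%R, 1%R] -> X}) W by exact: open_nbhs_nbhs.
move/uniform_nbhs => [E [entE EW]].
have [e /= e0 eE] : exists2 e, 0 < e & [set xy | ball xy.1 e xy.2] `<=` E.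
  by move: entE; rewrite -entourage_ballE => -[e e0 eE]; exists e.
exists e => // g' gg'; apply: EW => t t01; apply: eE => /=.
by rewrite ballEmdist/=; apply: gg'; rewrite inE in t01 *.
Qed.

End geodesic_facts.

Section metric_compact.
Context {R : realType} (X : pmetricType R).
Hypothesis cX : compact [set: X].

Lemma mdist_continuous (x : X) : continuous (mdist x).
Proof.
move=> y; apply/cvgrPdist_lt => e e0.
have : nbhs y (ball y e) by exact: nbhsx_ballx.
apply: filterS => z; rewrite ballEmdist/= => yz.
rewrite ltr_norml; have := metric_triangle x y z; have := metric_triangle x z y.
by rewrite (metric_sym z y) => h1 h2; apply/andP; split; lra.
Qed.

Lemma compact_diameter : exists2 D : R, 0 <= D & forall x y : X, mdist x y <= D.
Proof.
have : bounded_set (mdist (point : X) @` [set: X]).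
  apply: compact_bounded; apply: continuous_compact cX.
  by apply: continuous_subspaceT; exact: mdist_continuous.
move=> [M [_ /(_ (M + 1))]]; rewrite ltrDl => /(_ ltr01) h.
have hM (y : X) : mdist point y <= M + 1.
  by rewrite -[leLHS]ger0_norm ?mdist_ge0//; apply: h; exists y.
exists ((M + 1) + (M + 1)) => [|x y].
  by rewrite addr_ge0// (le_trans (mdist_ge0 _ _) (hM point)).
rewrite (le_trans (metric_triangle x point y))// lerD//.
by rewrite metric_sym.
Qed.

Lemma compact_dense_seq : exists a : nat -> X,
  forall x e, 0 < e -> exists k, mdist x (a k) < e.
Proof.
have [B cB [oB bB]] := compact_second_countable cX.
have [f finj] := countable_injP _ cB.
have /choice[a ha] : forall k, exists x : X,
    forall V, B V -> V !=set0 -> f V = k -> V x.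
  move=> k; have [[V [BV [x Vx] fV]]|h] :=
    pselect (exists V, [/\ B V, V !=set0 & f V = k]).
    exists x => W BW _ fW; rewrite (_ : W = V)//.
    by apply: finj; rewrite ?inE// fV.
  by exists point => V BV V0 fV; exfalso; apply: h; exists V.
exists a => x e e0.
have [V [BV Vx] Ve] : filter_from [set V | B V /\ V x] id (ball x e).
  by apply: bB; exact: nbhsx_ballx.
exists (f V); have : ball x e (a (f V)) by apply: Ve; apply: ha => //; exists x.
by rewrite ballEmdist.
Qed.

End metric_compact.

Section grid.
Context {R : realType}.

Lemma grid01 (n j : nat) : (j <= n.+1)%N -> j%:R / n.+1%:R \in `[0 : R, 1].
Proof.
move=> jn; rewrite in_itv/= divr_ge0//=.
by rewrite ler_pdivrMr// mul1r ler_nat.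
Qed.

Lemma grid_approx (n : nat) (t : R) : t \in `[0, 1] ->
  exists2 j : nat, (j <= n.+1)%N & `|t - j%:R / n.+1%:R| <= n.+1%:R^-1.
Proof.
rewrite in_itv/= => /andP[t0 t1].
have tn0 : 0 <= t * n.+1%:R by rewrite mulr_ge0.
have /andP[jl ju] := Num.Theory.truncn_itv tn0.
exists (Num.truncn (t * n.+1%:R)).
  rewrite -(ler_nat R); apply: le_trans jl _.
  by rewrite ler_piMl.
have n0 : 0 < n.+1%:R :> R by [].
rewrite ger0_norm ?subr_ge0 ?ler_pdivrMr//.
rewrite lerBlDr -[X in _ <= X + _]mul1r -mulrDl ler_pdivlMr//.
by rewrite addrC natr1 ltW.
Qed.

End grid.

Section measurable_geodesic.
Context {R : realType} (X : pmetricType R).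
Hypothesis cX : compact [set: X].

(** Since X is separable and geodesics are equi-Lipschitz, an open set of
geodesics is the countable union of the cylinders that it contains, where a
cylinder constrains the values at finitely many times. *)
Lemma measurable_fun_geodesic d (T : measurableType d) (F : T -> geodesic X) :
  (forall t, t \in `[0, 1] ->
    measurable_fun setT (fun w => eval_at t (F w : borel (geodesic X)))) ->
  measurable_fun setT (F : T -> borel (geodesic X)).
Proof.
move=> mF; apply: measurable_fun_borel => V oV.
have [a da] := compact_dense_seq cX.
have [D D0 hD] := compact_diameter cX.
(* the geodesics that are close, at each node of a uniform grid, to a
   prescribed point of the dense sequence *)
pose cyl (p : nat * seq nat) : set (geodesic X) := [set g |
  forall j, (j <= p.1.+1)%N ->
    ball (a (nth 0%N p.2 j)) p.1.+1%:R^-1 (eval_at (j%:R / p.1.+1%:R) g)].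
have mcyl p : measurable (F @^-1` cyl p).
  have -> : F @^-1` cyl p = \bigcap_(j in `I_p.1.+2)
      (fun w => eval_at (j%:R / p.1.+1%:R) (F w : borel (geodesic X))) @^-1`
        (ball (a (nth 0%N p.2 j)) p.1.+1%:R^-1).
    by apply/seteqP; split => w h j jp; apply: h.
  apply: bigcap_measurableType => j jp.
  rewrite -[X in measurable X]setTI; apply: mF => //; first exact: grid01.
  exact: measurable_mball.
have -> : F @^-1` V =
    \bigcup_p (if `[< cyl p `<=` V >] then F @^-1` cyl p else set0).
  apply/seteqP; split=> [w Vw|w [p _]]; last first.
    by case: ifPn => // /asboolP pV /pV.
  have [e e0 eV] := geodesic_nbhs oV Vw.
  (* on a grid of step 1/n.+1, two geodesics of the same cylinder differ by at
     most 2 * D / n.+1 (moving to the nearest node) plus 2 / n.+1 *)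
  have e0' : 0 < e / (2 * D + 2 + 1) by rewrite divr_gt0//; lra.
  have [n ne] := ex_invS_lt e0'.
  have /choice[s hs] : forall j, exists k,
      mdist (eval_at (j%:R / n.+1%:R) (F w : borel (geodesic X)) : X) (a k)
        < n.+1%:R^-1.
    by move=> j; exact: da.
  pose p := (n, [seq s j | j <- iota 0 n.+2]).
  pose Fw j : X := eval_at (j%:R / n.+1%:R) (F w : borel (geodesic X)).
  have np j : (j <= n.+1)%N -> nth 0%N p.2 j = s j.
    move=> jn; rewrite (nth_map 0%N) ?size_iota//.
    by rewrite nth_iota.
  exists p => //; case: ifPn => [_|/asboolP[]].
    by move=> j jn; rewrite np// ballEmdist/= metric_sym.
  move=> g gp; apply: eV => t t01.
  have [j jn tj] := grid_approx n t01.
  have j01 := @grid01 R n j jn.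
  have := gp j jn; rewrite /= np// ballEmdist/= => h1.
  have h2 : mdist (Fw j) (a (s j)) < n.+1%:R^-1 by exact: hs.
  have lip (h : geodesic X) :
      mdist (eval_at t h : X) (eval_at (j%:R / n.+1%:R) h) <= n.+1%:R^-1 * D.
    by rewrite eval_at_dist// ler_pM// mdist_ge0.
  have := lip g; rewrite metric_sym => h3.
  have h4 : mdist _ (Fw j) <= _ := lip (F w).
  apply: le_lt_trans (metric_triangle _ (Fw j) _) _.
  have h5 := metric_triangle (Fw j) (eval_at (j%:R / n.+1%:R) g) (eval_at t g).
  have h6 := metric_triangle (Fw j) (a (s j)) (eval_at (j%:R / n.+1%:R) g).
  have : n.+1%:R^-1 * (2 * D + 2 + 1) < e by rewrite -ltr_pdivlMr//; lra.
  have : 0 < n.+1%:R^-1 :> R by [].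
  move: h1 h2 h3 h4 h5 h6; move: (_^-1) => i h1 h2 h3 h4 h5 h6 h7.
  by rewrite mulrDr mulrDr mulrA [i * 2]mulrC -mulrA => h8; lra.
apply: countable_bigcupT_measurable; first exact: countableP.
by move=> p; case: ifP.
Qed.

End measurable_geodesic.

Section evaluation.
Context {R : realType} (X : pmetricType R).

(** A geodesic is extended to the whole line by constants, so that its value
at t is its value at the point of [0, 1] nearest to t. *)
Definition clip01 (t : R) : R := Num.max 0 (Num.min 1 t).

Lemma clip01_in t : clip01 t \in `[0, 1].
Proof. by rewrite in_itv/= /clip01 le_max lexx/= ge_max ler01 ge_min lexx. Qed.

Lemma clip01_lip s t : `|clip01 s - clip01 t| <= `|s - t|.
Proof.
wlog st : s t / s <= t.
  move=> h; have [|/ltW] := leP s t; first exact: h.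
  by rewrite (distrC (clip01 s)) (distrC s); exact: h.
have min1 (u : R) : Num.min 1 u <= 1 by rewrite ge_min lexx.
have minu (u : R) : Num.min 1 u <= u by rewrite ge_min lexx orbT.
have mono : clip01 s <= clip01 t.
  rewrite /clip01 ge_max !le_max lexx/=; apply/orP; right.
  by rewrite le_min min1 (le_trans (minu s)).
rewrite (distrC (clip01 s)) (distrC s) !ger0_norm ?subr_ge0// lerBlDl.
have clip0 : 0 <= clip01 s by rewrite /clip01 le_max lexx.
rewrite {1}/clip01 ge_max addr_ge0 ?subr_ge0//= -lerBlDr.
rewrite /clip01 le_max le_min; apply/orP; right.
by have := min1 t; have := minu t => h1 h2; apply/andP; split; lra.
Qed.

Lemma eval_at_clip01 t (g : borel (geodesic X)) :
  eval_at t g = eval_at (clip01 t) g.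
Proof.
rewrite /clip01 /Num.max /Num.min; case: (ltP 1 t) => t1.
  by rewrite ltr01 eval_at_ge1// ltW.
by case: ltP => // t0; exact: eval_at_le0.
Qed.

Lemma measurable_eval_atT t : measurable_fun setT (@eval_at R X t).
Proof.
have -> : @eval_at R X t = @eval_at R X (clip01 t).
  by apply/funext => g; exact: eval_at_clip01.
by apply: measurable_eval_at; exact: clip01_in.
Qed.

Lemma measurable_endpoints : measurable_fun setT (@endpoints R X).
Proof. by apply: measurable_fun_pair; exact: measurable_eval_atT. Qed.

Lemma eval_at_lip s t (g : borel (geodesic X)) :
  mdist (eval_at s g : X) (eval_at t g) <=
  `|s - t| * mdist (eval_at 0 g : X) (eval_at 1 g).
Proof.
rewrite eval_at_clip01 [in X in mdist _ X](eval_at_clip01 t).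
by rewrite eval_at_dist ?clip01_in// ler_wpM2r ?mdist_ge0// clip01_lip.
Qed.

Variable P : probability (borel (geodesic X)) R.
Hypothesis cX : compact [set: X].
Local Open Scope ereal_scope.

Lemma measurable_eval_at_set t (A : set (borel X)) : measurable A ->
  measurable (@eval_at R X t @^-1` A).
Proof.
by move=> mA; rewrite -[X in measurable X]setTI; exact: measurable_eval_atT.
Qed.

(** This function of t is lower semicontinuous. *)
Lemma measurable_prob_eval_open (V : set X) : open V ->
  measurable_fun [set: R] (fun t : R => P (@eval_at R X t @^-1` V)).
Proof.
move=> oV; apply: lower_semicontinuous_measurable => t a aV.
have mV := measurable_eval_at_set t (measurable_open_borel oV).
have fV : P (@eval_at R X t @^-1` V) \is a fin_num by rewrite fin_num_measure.
have cV : closed (~` V) by exact: open_closedC.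
pose F n := @eval_at R X t @^-1` thickening (~` V) n.+1%:R^-1.
have mF n : measurable (F n).
  by apply: measurable_eval_at_set; apply: measurable_open_borel; exact: open_thickening.
have dF : nonincreasing_seq F.
  by move=> m n mn; apply/subsetPset; apply: preimage_subset; exact: thickening_decr.
have IF : \bigcap_n F n `<=` @eval_at R X t @^-1` (~` V).
  by move=> g Fg; rewrite -(bigcap_thickening cV).
pose d := ((fine (P (@eval_at R X t @^-1` V)) - a) / 2)%R.
have d0 : (0 < d)%R.
  by rewrite divr_gt0// subr_gt0 -lte_fin fineK.
(* most of the geodesics that are in V at time t are so with a margin 1/n.+1,
   which is also the distance that they cannot cover before the time s *)
have [n Fn] := probability_decr_le P mF (measurableC mV) dF IF d0.
have [D D0 hD] := compact_diameter cX.
have e0 : (0 < n.+1%:R^-1 / (D + 1) :> R)%R by rewrite divr_gt0// ltr_wpDl.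
exists (ball t (n.+1%:R^-1 / (D + 1))); first exact: nbhsx_ballx.
move=> s; rewrite -ball_normE/= => ts.
have mVs := measurable_eval_at_set s (measurable_open_borel oV).
have : P (~` F n) <= P (@eval_at R X s @^-1` V).
  apply: le_measure; rewrite ?inE//; first exact: measurableC.
  move=> g nFg; apply: contrapT => nVg; apply: nFg; exists (eval_at s g) => //.
  apply: le_lt_trans (eval_at_lip s t g) _; rewrite distrC.
  rewrite ltr_pdivlMr ?ltr_wpDl// in ts; apply: le_lt_trans ts.
  by rewrite ler_wpM2l// (le_trans (hD _ _))// lerDl.
apply: lt_le_trans; rewrite probability_setC//.
have fF : P (F n) \is a fin_num by rewrite fin_num_measure.
move: Fn; rewrite preimage_setC probability_setC// -(fineK fV) -(fineK fF).
rewrite -!EFinB -EFinD lee_fin lte_fin /d => h.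
have : (a < fine (P (@eval_at R X t @^-1` V)))%R by rewrite -lte_fin fineK.
by move: h; set u := fine _; set v := fine _ => h1 h2; lra.
Qed.

Lemma measurable_prob_eval_closed (K : set X) : closed K ->
  measurable_fun [set: R] (fun t : R => P (@eval_at R X t @^-1` K)).
Proof.
move=> cK; have oK : open (~` K) by exact: closed_openC.
rewrite (_ : (fun t => _) = (fun t => 1 - P (@eval_at R X t @^-1` (~` K)))).
  by apply: emeasurable_funB => //; exact: measurable_prob_eval_open.
apply/funext => t; rewrite preimage_setC -probability_setC ?setCK//.
by apply: measurableC; apply: measurable_eval_at_set; exact: measurable_closed_borel.
Qed.

End evaluation.

(** * Standard part of a sequence of geodesics *)

Lemma cvg0_norm_lt {R : realType} (u : nat -> R) (e : R) :
  u i @[i --> \oo] --> 0 -> 0 < e -> \forall i \near \oo, `|u i| < e.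
Proof.
move=> /cvgrPdist_lt u0 e0; apply: filterS (u0 e e0) => i.
by rewrite sub0r normrN.
Qed.

Lemma scaled_dist_le {R : realFieldType} (u v b c e : R) : 0 <= c -> c <= 1 ->
  `|u - c * b| < 3 * (e / 6) -> `|v - b| < 3 * (e / 6) -> `|u - c * v| <= e.
Proof.
move=> c0 c1 h1 h2.
have -> : u - c * v = (u - c * b) - c * (v - b) by ring.
rewrite (le_trans (ler_normB _ _))// normrM (ger0_norm c0).
have : c * `|v - b| <= 1 * `|v - b| by rewrite ler_wpM2r.
by lra.
Qed.

Section standard_part.
Context {R : realType} (X_ : nat -> pmetricType R) (X : pmetricType R)
  (f : forall i, {mfun borel (X_ i) >-> borel X}) (eps : nat -> R)
  (U : set_system nat).
Hypothesis FU : UltraFilter U.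
Hypothesis oo_sub : eventually `<=` U.
Hypothesis eps_cvg : eps i @[i --> \oo] --> 0.
Hypothesis f_isom : forall i (x x' : X_ i),
  `|mdist (f i x : X) (f i x' : X) - mdist x x'| <= eps i.
Hypothesis cX : compact [set: X].

Lemma ultra_cvg (u : nat -> X) : exists x : X, u i @[i --> U] --> x.
Proof.
have [|x [_ ux]] := cX (F := u @ U) _; first exact: filterT.
exists x => V Vx; have [//|UnV] := in_ultra_setVsetC (u @^-1` V) FU.
by have [y []] := ux (~` V) V UnV Vx.
Qed.

Lemma near_eps (e : R) : 0 < e -> \forall i \near U, `|eps i| < e.
Proof. by move=> e0; apply: oo_sub; exact: cvg0_norm_lt. Qed.

(** The maps f_i are almost isometries, so the pointwise limits satisfy the
identity d(g s, g t) = |s - t| d(g 0, g 1) of geodesics. *)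
Lemma limit_geodesic (w : forall i, geodesic (X_ i)) : exists g : geodesic X,
  forall t, t \in `[0, 1] ->
    (f i (eval_at t (w i)) : X) @[i --> U] --> (eval_at t g : X).
Proof.
have /choice[x xP] : forall t, exists x : X,
    (f i (eval_at t (w i)) : X) @[i --> U] --> x.
  by move=> t; exact: ultra_cvg.
pose h t := if t <= 0 then x 0 else if 1 <= t then x 1 else x t.
have hE t : t \in `[0, 1] -> h t = x t.
  rewrite in_itv/= /h => /andP[t0 t1].
  case: ifPn => [t0'|_]; first by congr x; apply/eqP; rewrite eq_le t0 t0'.
  by case: ifPn => // t1'; congr x; apply/eqP; rewrite eq_le t1 t1'.
have z01 : 0 \in `[0 : R, 1] by rewrite in_itv/= lexx ler01.
have o01 : 1 \in `[0 : R, 1] by rewrite in_itv/= lexx ler01.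
have near_dist (s t e : R) : 0 < e -> \forall i \near U,
    `|mdist (x s) (x t) - mdist (eval_at s (w i) : X_ i) (eval_at t (w i))|
      < 3 * e.
  move=> e0; apply: filterS3 (near_eps e0) (xP s _ (nbhsx_ballx _ _ e0))
    (xP t _ (nbhsx_ballx _ _ e0)) => i.
  rewrite /= !ballEmdist/= => ei xs xt.
  have := @f_isom i (eval_at s (w i)) (eval_at t (w i)).
  move: xs xt; set a : X := f i (eval_at s (w i)); set b : X := f i (eval_at t (w i)).
  move=> xs xt; rewrite ler_norml => /andP[h1 h2].
  move: ei; rewrite ltr_norml => /andP[h3 h4].
  have h5 := metric_triangle (x s) a (x t).
  have h6 := metric_triangle a b (x t).
  have h7 := metric_triangle a (x s) b.
  have h8 := metric_triangle (x s) (x t) b.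
  rewrite (metric_sym a (x s)) in h7; rewrite (metric_sym b (x t)) in h6.
  by rewrite ltr_norml; apply/andP; split; lra.
have hg : geodesics (h : {uniform` `[0%R, 1%R] -> X}).
  split; last first.
    split=> t t0; rewrite /h ?lexx ?t0//.
    have -> : (t <= 0) = false by apply/negbTE; rewrite -ltNge; lra.
    by rewrite ler10.
  move=> s t s01 t01; rewrite !hE//.
  apply/eqP; rewrite -subr_eq0 -normr_le0; apply/ler_addgt0Pl => e e0; rewrite addr0.
  have e60 : 0 < e / 6 by rewrite divr_gt0.
  have [i [h1 h2]] := filter_ex (filterI (near_dist s t _ e60) (near_dist 0 1 _ e60)).
  rewrite eval_at_dist// in h1.
  apply: (scaled_dist_le _ _ h1 h2); rewrite ?normr_ge0//.
  move: s01 t01; rewrite !in_itv/= => /andP[? ?] /andP[? ?].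
  by rewrite ler_norml; apply/andP; split; lra.
exists (SigSub (mem_set hg)) => t t01.
have -> : eval_at t (SigSub (mem_set hg) : borel (geodesic X)) = h t by [].
by rewrite hE.
Qed.

Definition standard_part (w : forall i, geodesic (X_ i)) : geodesic X :=
  projT1 (cid (limit_geodesic w)).

Lemma standard_part_cvg w t : t \in `[0, 1] ->
  (f i (eval_at t (w i)) : X) @[i --> U] --> (eval_at t (standard_part w) : X).
Proof. exact: (projT2 (cid (limit_geodesic w))). Qed.

Definition passes_near (K : set X) (r t : R) (i : nat) :
    set (borel (geodesic (X_ i))) :=
  [set g | thickening K r (f i (eval_at t g))].

Arguments passes_near : clear implicits.

Lemma measurable_passes_near K r t i : t \in `[0, 1] ->
  measurable (passes_near K r t i).
Proof.
move=> t01; have mft : measurable_fun setT (f i \o @eval_at R (X_ i) t).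
  by apply: measurableT_comp => //; exact: measurable_eval_at.
rewrite -[passes_near _ _ _ _]setTI; apply: mft => //.
by apply: measurable_open_borel; exact: open_thickening.
Qed.

(** The standard part being in K at time t is covered by an internal event:
this turns bounds on the Pi_i into bounds on the limit plan. *)
Lemma standard_part_near K r t w : 0 < r -> t \in `[0, 1] ->
  K (eval_at t (standard_part w)) -> internal U (passes_near K r t) w.
Proof.
move=> r0 t01 Kw; have := @standard_part_cvg w _ t01 _ (nbhsx_ballx _ _ r0).
by apply: filterS => i; rewrite ballEmdist/= => h; exists (eval_at t (standard_part w)).
Qed.

Lemma standard_part_closed K t w : closed K -> t \in `[0, 1] ->
  (forall n, internal U (passes_near K n.+1%:R^-1 t) w) ->
  K (eval_at t (standard_part w)).
Proof.
move=> cK t01 Kw; rewrite (closure_id K).1// => B /nbhs_ballP[e /= e0 eB].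
have e20 : 0 < e / 2 by lra.
have [n ne] := ex_invS_lt e20.
have [i [[z Kz zi] wi]] := filter_ex (filterI (Kw n)
  (@standard_part_cvg w _ t01 _ (nbhsx_ballx _ _ e20))).
exists z; split => //; apply: eB; rewrite ballEmdist/=.
move: wi; rewrite /= ballEmdist/= => wi.
apply: le_lt_trans (metric_triangle _ (f i (eval_at t (w i)) : X) _) _.
by rewrite (splitr e) ltrD// metric_sym (lt_trans zi).
Qed.

(** Being in a closed set at time t is a countable intersection of internal
events. *)
Lemma measurable_standard_part d (M : measurableType d)
    (w : M -> forall i, borel (geodesic (X_ i))) :
  (forall A : forall i, set (borel (geodesic (X_ i))),
     (forall i, measurable (A i)) -> measurable (w @^-1` internal U A)) ->
  measurable_fun setT
    (fun m : M => standard_part (w m) : borel (geodesic X)).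
Proof.
move=> mw; apply: (measurable_fun_geodesic cX) => t t01.
apply: measurable_fun_borel => V oV.
have cV : closed (~` V) by exact: open_closedC.
rewrite (_ : _ @^-1` V = ~` \bigcap_n (w @^-1`
    internal U (passes_near (~` V) n.+1%:R^-1 t))).
  apply: measurableC; apply: bigcap_measurableType => n _; apply: mw => i.
  exact: measurable_passes_near.
apply/seteqP; split=> [m Vm Im|m Im].
  by apply: (standard_part_closed cV t01 _ Vm) => n; exact: Im.
apply: contrapT => nVm; apply: Im => n _.
exact: standard_part_near.
Qed.

End standard_part.

Arguments passes_near {R X_ X} f K r t i.

(** * Asymptotic bounds for closed sets and balls *)

Section length_balls.
Context {R : realType} (X : pmetricType R).

(** If d(x, y) = r, a curve from x to y of length less than r + e/2 has a
point z slightly closer to x than r; what is left of the length after z bounds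
d(z, y). *)
Lemma length_space_closed_ball (x y : X) (r : R) : length_space X -> 0 < r ->
  mdist x y <= r -> closure (ball x r) y.
Proof.
move=> lX r0; rewrite le_eqVlt => /orP[/eqP xyr|xyr]; last first.
  by apply: subset_closure; rewrite ballEmdist.
move=> B /nbhs_ballP[e /= e0 eB].
pose del := Num.min e r / 2.
have d0 : 0 < del by rewrite divr_gt0// lt_min e0.
have de : del <= e / 2 by rewrite ler_pM2r// ge_min lexx.
have dr : del <= r / 2 by rewrite ler_pM2r// ge_min lexx orbT.
have : (ereal_inf (@curve_length R X @` curves x y) < (r + e / 2)%:E)%E.
  by rewrite -lX xyr lte_fin ltrDl divr_gt0.
move=> /ereal_inf_lt[_ [c [cc [c0 c1]] <-]] lc.
(* the point of a nearly shortest curve at distance r - del from x *)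
have [t t01 ct] : exists2 t, t \in `[0, 1] & mdist x (c t) = r - del.
  apply: (@IVT _ (fun t => mdist x (c t))) => //.
    apply: (@within_continuous_comp X R R `[0, 1]%classic c (mdist x)) => //.
    by move=> z _; exact: mdist_continuous.
  rewrite c0 c1 mdistxx xyr ge_min le_max.
  by apply/andP; split; apply/orP; [left|right]; lra.
have t0 : 0 < t.
  move: t01; rewrite in_itv/= le_eqVlt => /andP[/orP[/eqP t0|//]] _.
  by move: ct; rewrite -t0 c0 mdistxx => h; lra.
have t1 : t < 1.
  move: t01; rewrite in_itv/= [t <= 1]le_eqVlt => /andP[_ /orP[/eqP t1|//]].
  by move: ct; rewrite t1 c1 xyr => h; lra.
exists (c t); split; first by rewrite ballEmdist/= ct; lra.
apply: eB; rewrite ballEmdist/= metric_sym.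
have : ((polygonal_length c [:: t; 1])%:E <= curve_length c)%E.
  apply: ereal_sup_ubound; exists [:: t; 1] => //.
  by split; rewrite /= ?t0 ?t1.
move=> /le_lt_trans/(_ lc); rewrite lte_fin /polygonal_length/=.
rewrite !big_nat_recr//= big_nil/= add0r c0 c1 ct.
by move=> h; lra.
Qed.

End length_balls.

Section convergence_bounds.
Context {R : realType} (X_ : nat -> pmetricType R)
  (nu_ : forall i, probability (borel (X_ i)) R)
  (X : pmetricType R) (nu : probability (borel X) R)
  (f : forall i, {mfun borel (X_ i) >-> borel X}) (eps : nat -> R).
Hypothesis eps_cvg : eps i @[i --> \oo] --> 0.
Hypothesis f_isom : forall i (x x' : X_ i),
  `|mdist (f i x : X) (f i x' : X) - mdist x x'| <= eps i.
Hypothesis nu_cvg : weak_star_cvg (fun i => distribution (nu_ i) (f i)) nu.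
Local Open Scope ereal_scope.

(** Upper semicontinuity of the masses of closed sets under weak convergence,
combined with continuity from above. *)
Lemma decr_closed_le (F : nat -> set X) (Q : set (borel X)) (e : R) :
    (forall n, closed (F n)) -> measurable Q ->
    (forall m n, (m <= n)%N -> F n `<=` F m) ->
    \bigcap_n F n `<=` Q -> (0 < e)%R ->
  exists n, \forall i \near \oo, nu_ i (f i @^-1` F n) <= nu Q + e%:E.
Proof.
move=> cF mQ dF FQ e0; have e20 : (0 < e / 2)%R by rewrite divr_gt0.
have dF' : nonincreasing_seq F by move=> m n mn; apply/subsetPset; exact: dF.
have [n Fn] := probability_decr_le nu
  (fun n => measurable_closed_borel (cF n)) mQ dF' FQ e20.
exists n; apply: filterS (portmanteau_closed nu_cvg (cF n) e20) => i h.
apply: (le_trans h); apply: (le_trans (leeD2r _ Fn)).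
by rewrite -addeA -EFinD -splitr.
Qed.

Lemma closed_mdist_le (x : X) (r : R) : closed [set y | (mdist x y <= r)%R].
Proof.
rewrite (_ : mkset _ = mdist x @^-1` [set u | (u <= r)%R])//.
by apply: closed_comp => [y _|]; [exact: mdist_continuous|exact: closed_le].
Qed.

Lemma closed_mdist_ge (x : X) (r : R) : closed [set y | (r <= mdist x y)%R].
Proof.
rewrite (_ : mkset _ = mdist x @^-1` [set u | (r <= u)%R])//.
by apply: closed_comp => [y _|]; [exact: mdist_continuous|exact: closed_ge].
Qed.

Lemma bigcap_closure_thickening (K : set X) : closed K ->
  \bigcap_n closure (thickening K n.+1%:R^-1) `<=` K.
Proof.
move=> cK x Kx; rewrite -(bigcap_thickening cK) => n _.
apply: closure_thickening (Kx n.+1 I).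
by rewrite ltf_pV2 ?posrE// ltr_nat.
Qed.

Lemma thickening_limsup (K : set X) (e : R) : closed K -> (0 < e)%R ->
  exists n, \forall i \near \oo,
    nu_ i (f i @^-1` thickening K n.+1%:R^-1) <= nu K + e%:E.
Proof.
move=> cK e0.
have [n h] := decr_closed_le (fun n => @closed_closure _ (thickening K n.+1%:R^-1))
  (measurable_closed_borel cK) (fun m n mn => closure_subset (thickening_decr mn))
  (bigcap_closure_thickening cK) e0.
exists n; apply: filterS h => i; apply: le_trans.
apply: le_measure; rewrite ?inE.
- by apply: measurable_funPTI; apply: measurable_open_borel; exact: open_thickening.
- by apply: measurable_funPTI; apply: measurable_closed_borel; exact: closed_closure.
- by apply: preimage_subset; exact: subset_closure.
Qed.

Variables (x : X) (x_ : forall i, X_ i) (r : R).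
Hypothesis r0 : (0 < r)%R.
Hypothesis x_cvg : forall i, (mdist (f i (x_ i) : X) x <= eps i)%R.

Lemma image_ball_lt i (y : X_ i) (d : R) : (2 * `|eps i| < d)%R ->
  (mdist (x_ i) y < r)%R -> (mdist x (f i y : X) <= r + d)%R.
Proof.
move=> ed xy; have := @f_isom i (x_ i) y; rewrite ler_norml => /andP[_ h].
have := metric_triangle x (f i (x_ i) : X) (f i y).
rewrite (metric_sym x (f i (x_ i) : X)); have := x_cvg i; have := ler_norm (eps i).
by move: h => /=; lra.
Qed.

Lemma image_ball_ge i (y : X_ i) (d : R) : (2 * `|eps i| < d)%R ->
  (r <= mdist (x_ i) y)%R -> (r - d <= mdist x (f i y : X))%R.
Proof.
move=> ed xy; have := @f_isom i (x_ i) y; rewrite ler_norml => /andP[h _].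
have := metric_triangle (f i (x_ i) : X) x (f i y).
have := x_cvg i; have := ler_norm (eps i).
by move: h => /=; lra.
Qed.

(** Points of X_i outside the ball around x_i are sent by f_i outside a
slightly smaller ball around x, so this is an upper bound on the complement. *)
Lemma ball_liminf (e : R) : (0 < e)%R ->
  \forall i \near \oo, nu (ball x r) <= nu_ i (ball (x_ i) r) + e%:E.
Proof.
move=> e0; pose F (n : nat) := [set y | (r - n.+1%:R^-1 <= mdist x y)%R].
have mB := measurable_mball x r.
have dF (m n : nat) : (m <= n)%N -> F n `<=` F m.
  move=> mn y; apply: le_trans; rewrite lerB// lef_pV2 ?posrE// ler_nat//.
have IF : \bigcap_n F n `<=` ~` ball x r.
  move=> y Fy; rewrite ballEmdist/= => xy.
  have [n ne] := @ex_invS_lt _ (r - mdist x y) ltac:(by rewrite subr_gt0).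
  by move: ne; rewrite ltrBrDl -ltrBrDr ltNge (Fy n I).
have [n h] := decr_closed_le (fun n => @closed_mdist_ge x (r - n.+1%:R^-1))
  (measurableC mB) dF IF e0.
have d0 : (0 < n.+1%:R^-1 / 2 :> R)%R by rewrite divr_gt0.
apply: filterS2 h (cvg0_norm_lt eps_cvg d0) => i h ei.
have mBi := measurable_mball (x_ i) r.
have : nu_ i (~` ball (x_ i) r) <= nu_ i (f i @^-1` F n).
  apply: le_measure; rewrite ?inE; first exact: measurableC.
    apply: measurable_funPTI.
    by apply: measurable_closed_borel; exact: closed_mdist_ge.
  move=> y /=; rewrite ballEmdist/= => /negP; rewrite -leNgt.
  by apply: image_ball_ge; rewrite mulrC -ltr_pdivlMr.
move=> /le_trans/(_ h); rewrite !probability_setC//.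
have f1 : nu (ball x r) \is a fin_num by rewrite fin_num_measure.
have f2 : nu_ i (ball (x_ i) r) \is a fin_num by rewrite fin_num_measure.
rewrite -(fineK f1) -(fineK f2) -EFinB -EFinD !lee_fin => {}h; lra.
Qed.

(** The closed sets of points near K at distance at most r + 1/n from x
decrease to the intersection of K with the closed ball, and the sphere is
null. *)
Lemma thickening_ball_limsup (K : set X) (e : R) :
    nu (ball x r) = nu (closure (ball x r)) -> length_space X ->
    closed K -> (0 < e)%R ->
  exists n, \forall i \near \oo,
    nu_ i (f i @^-1` thickening K n.+1%:R^-1 `&` ball (x_ i) r)
      <= nu (K `&` ball x r) + e%:E.
Proof.
move=> nuB lX cK e0.
pose F (n : nat) := closure (thickening K n.+1%:R^-1) `&`
  [set y | (mdist x y <= r + n.+1%:R^-1)%R].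
have mB := measurable_mball x r.
have mK := measurable_closed_borel cK.
have cF n : closed (F n) by apply: closedI; [exact: closed_closure|exact: closed_mdist_le].
have dF (m n : nat) : (m <= n)%N -> F n `<=` F m.
  move=> mn y [yK yr]; split; first exact: closure_subset (thickening_decr mn) _ yK.
  by apply: (le_trans yr); rewrite lerD2l lef_pV2 ?posrE// ler_nat.
have mcl : measurable (closure (ball x r) : set (borel X)).
  by apply: measurable_closed_borel; exact: closed_closure.
have IF : \bigcap_n F n `<=` K `&` closure (ball x r).
  move=> y Fy; split.
    by apply: (bigcap_closure_thickening cK) => n _; have [] := Fy n I.
  apply: length_space_closed_ball => //; apply/ler_addgt0Pr => d d0.
  have [n ne] := ex_invS_lt d0; have [_ /= yr] := Fy n I.
  by apply: (le_trans yr); rewrite lerD2l ltW.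
have [n h] := decr_closed_le cF (measurableI _ _ mK mcl) dF IF e0.
have d0 : (0 < n.+1%:R^-1 / 2 :> R)%R by rewrite divr_gt0.
exists n; apply: filterS2 h (cvg0_norm_lt eps_cvg d0) => i h ei.
have mBi := measurable_mball (x_ i) r.
apply: (@le_trans _ _ (nu_ i (f i @^-1` F n))).
  apply: le_measure; rewrite ?inE.
  - apply: measurableI => //.
    by apply: measurable_funPTI; apply: measurable_open_borel; exact: open_thickening.
  - by apply: measurable_funPTI; exact: measurable_closed_borel.
  - move=> y [yK]; rewrite ballEmdist/= => yr; split; first exact: subset_closure.
    by apply: image_ball_lt => //; rewrite mulrC -ltr_pdivlMr.
apply: (le_trans h); rewrite leeD2r//.
have mD : measurable (closure (ball x r) `\` ball x r : set (borel X)) by exact: measurableD.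
have nD : nu (closure (ball x r) `\` ball x r) = 0.
  have : nu (closure (ball x r)) =
      nu (closure (ball x r) `\` ball x r) + nu (ball x r).
    by rewrite (measureDI nu mcl mB) (setIidr (@subset_closure _ _)).
  rewrite -nuB.
  have f1 : nu (ball x r) \is a fin_num by rewrite fin_num_measure.
  have f2 : nu (closure (ball x r) `\` ball x r) \is a fin_num by rewrite fin_num_measure.
  by rewrite -(fineK f1) -(fineK f2) => -[h']; congr (_%:E); lra.
rewrite -[leRHS]adde0 -nD; apply: le_trans (measureU2 _ _ _) => //; last first.
  exact: measurableI.
apply: le_measure; rewrite ?inE.
- exact: measurableI.
- by apply: measurableU => //; exact: measurableI.
- by move=> y [Ky cy]; have [By|nBy] := pselect (ball x r y); [left|right].
Qed.

End convergence_bounds.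

(** * The limit plan *)

(** The choice of e' makes (a + e') / (b - e') at most a / b + e when a <= b. *)
Lemma ratio_le {R : realFieldType} (a b a' b' e e' : R) :
  0 <= a -> a <= b -> 0 < b -> 0 < e -> e' = e * b / (2 + e) ->
  a' <= a + e' -> b <= b' + e' -> a' / b' <= a / b + e.
Proof.
move=> a0 ab b0 e0 e'E a'le b'ge.
have e2 : 0 < 2 + e by lra.
have e'e : e' * (2 + e) = e * b by rewrite e'E divfK// gt_eqF.
have e'0 : 0 < e' by rewrite e'E divr_gt0// mulr_gt0.
have e'b : e' < b by rewrite -(ltr_pM2r e2) e'e mulrC ltr_pM2l//; lra.
have b'0 : 0 < b' by lra.
rewrite ler_pdivrMr//; apply: (le_trans a'le).
have q0 : 0 <= a / b by rewrite divr_ge0// ltW.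
have q1 : a / b <= 1 by rewrite ler_pdivrMr// mul1r.
have aE : a = a / b * b by rewrite divfK// gt_eqF.
move: q0 q1 aE; set q := a / b => q0 q1 aE.
have h1 : (q + e) * (b - e') <= (q + e) * b' by rewrite ler_wpM2l//; lra.
apply: le_trans h1; rewrite {1}aE mulrDl !mulrBr.
have h2 : q * e' <= 1 * e' by rewrite ler_wpM2r// ltW.
by rewrite mulrDr in e'e; lra.
Qed.

(** The passage to the limit e --> 0 in (I - e) (c - e) <= C (k + e). *)
Lemma le_ratio_of_approx {R : realFieldType} (I k C c : R) :
  0 <= I -> 0 < C -> 0 < c -> 0 <= k ->
  (forall e, 0 < e -> e < c -> (I - e) * (c - e) <= C * (k + e)) ->
  I <= C / c * k.
Proof.
move=> I0 C0 c0 k0 h; rewrite mulrAC ler_pdivlMr// leNgt; apply/negP => lt.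
pose d := I * c - C * k; have d0 : 0 < d by rewrite subr_gt0.
pose s := C + I + c; have s0 : 0 < s by rewrite /s; lra.
pose e := Num.min (c / 2) (d / s / 2).
have e0 : 0 < e by rewrite lt_min !divr_gt0.
have e1 : e <= c / 2 by rewrite ge_min lexx.
have e2 : e <= d / s / 2 by rewrite ge_min lexx orbT.
have e3 : e * s <= d / 2.
  rewrite -ler_pdivlMr//; apply: (le_trans e2).
  by rewrite mulrAC.
have := h e e0 ltac:(lra); rewrite mulrBl !mulrBr mulrDr.
have : 0 <= e * e by rewrite mulr_ge0// ltW.
by move: e3; rewrite /s !mulrDr /d => h1 h2 h3; lra.
Qed.

Section limit_plan.
Context {R : realType} (C : R) (X_ : nat -> pmetricType R)
  (nu_ : forall i, probability (borel (X_ i)) R)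
  (X : pmetricType R) (nu : probability (borel X) R)
  (f : forall i, {mfun borel (X_ i) >-> borel X}) (eps : nat -> R).
Hypothesis C0 : 0 < C.
Hypothesis cX : compact [set: X].
Hypothesis lX : length_space X.
Hypothesis eps_cvg : eps i @[i --> \oo] --> 0.
Hypothesis f_isom : forall i (x x' : X_ i),
  `|mdist (f i x : X) (f i x' : X) - mdist x x'| <= eps i.
Hypothesis nu_cvg : weak_star_cvg (fun i => distribution (nu_ i) (f i)) nu.
Variables (x : X) (x_ : forall i, X_ i) (r : R).
Hypothesis r0 : 0 < r.
Hypothesis x_cvg : forall i, mdist (f i (x_ i) : X) x <= eps i.
Hypothesis nuB : nu (ball x r) = nu (closure (ball x r)).
Hypothesis B0 : (0 < nu (ball x r))%E.
Local Open Scope ereal_scope.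

Let c := fine (nu (ball x r)).

Let mB := measurable_mball x r.

Let fB : nu (ball x r) = c%:E.
Proof. by rewrite /c fineK// fin_num_measure. Qed.

Let c0 : (0 < c)%R. Proof. by rewrite -lte_fin -fB. Qed.

Let mthick i n (K : set X) : measurable (f i @^-1` thickening K n.+1%:R^-1).
Proof.
apply: measurable_funPTI.
by apply: measurable_open_borel; exact: open_thickening.
Qed.

Lemma near_ball_gt0 : \forall i \near \oo, 0 < nu_ i (ball (x_ i) r).
Proof.
have c20 : (0 < c / 2)%R by rewrite divr_gt0.
apply: filterS (ball_liminf eps_cvg f_isom nu_cvg r x_cvg c20) => i.
rewrite fB; have mBi := measurable_mball (x_ i) r.
have f1 : nu_ i (ball (x_ i) r) \is a fin_num by rewrite fin_num_measure.
by rewrite -(fineK f1) -EFinD lee_fin lte_fin => h; lra.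
Qed.

(** Portmanteau inequality for the normalized restrictions to the balls. *)
Lemma normalized_ball_limsup (K : set X) (e : R) : closed K -> (0 < e)%R ->
  exists n, \forall i \near \oo,
    normalized_ball (nu_ i) (x_ i) r (f i @^-1` thickening K n.+1%:R^-1)
      <= normalized_ball nu x r K + e%:E.
Proof.
move=> cK e0; pose e' := (e * c / (2 + e))%R.
have e'0 : (0 < e')%R by rewrite divr_gt0 ?mulr_gt0//; lra.
have mK := measurable_closed_borel cK.
have [n h] := thickening_ball_limsup eps_cvg f_isom nu_cvg r0 x_cvg nuB lX cK e'0.
exists n; apply: filterS3 h near_ball_gt0
  (ball_liminf eps_cvg f_isom nu_cvg r x_cvg e'0) => i.
move=> h1 Bi0 h2; rewrite !normalized_ballE//.
have mBi := measurable_mball (x_ i) r.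
have mT := @mthick i n K.
have f1 : nu_ i (f i @^-1` thickening K n.+1%:R^-1 `&` ball (x_ i) r)
    \is a fin_num.
  by rewrite fin_num_measure//; exact: measurableI.
have f2 : nu (K `&` ball x r) \is a fin_num.
  by rewrite fin_num_measure//; exact: measurableI.
have f3 : nu_ i (ball (x_ i) r) \is a fin_num by rewrite fin_num_measure.
rewrite -(fineK f1) -(fineK f2) -!EFinM -EFinD lee_fin.
apply: (@ratio_le _ _ _ _ _ _ e') => //.
- exact: fine_ge0.
- have : nu (K `&` ball x r) <= nu (ball x r).
    by apply: le_measure; rewrite ?inE//; exact: measurableI.
  by rewrite fB -(fineK f2) lee_fin.
- by move: h1; rewrite -(fineK f1) -(fineK f2) -EFinD lee_fin.
- by move: h2; rewrite fB -(fineK f3) -EFinD lee_fin.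
Qed.

Variables (U : set_system nat) (FU : UltraFilter U).
Hypothesis oo_sub : eventually `<=` U.
Variable Pi_ : forall i, probability (borel (geodesic (X_ i))) R.
Hypothesis plan : forall i, 0 < nu_ i (ball (x_ i) r) ->
  dynamical_democratic_plan (normalized_ball (nu_ i) (x_ i) r) (Pi_ i).
Hypothesis bound : forall i, 0 < nu_ i (ball (x_ i) r) ->
  forall A : set (borel (X_ i)), measurable A ->
    \int[lebesgue_measure]_(t in `[0%R, 1%R])
      pushforward (Pi_ i) (@eval_at R (X_ i) t) A
    <= (C / fine (nu_ i (ball (x_ i) r)))%:E * nu_ i A.
Variables (disp : measure_display) (M : measurableType disp)
  (L : probability M R) (w : M -> forall i, borel (geodesic (X_ i))).
Hypothesis mw : forall A : forall i, set (borel (geodesic (X_ i))),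
  (forall i, measurable (A i)) -> measurable (w @^-1` internal U A).
Hypothesis L_le : forall (S : set M)
    (A : forall i, set (borel (geodesic (X_ i)))) (a : \bar R), measurable S ->
  (forall i, measurable (A i)) -> S `<=` w @^-1` internal U A ->
  (\forall i \near U, Pi_ i (A i) <= a) -> L S <= a.

Let st (m : M) : borel (geodesic X) :=
  standard_part FU oo_sub eps_cvg f_isom cX (w m).

Let mst : measurable_fun setT st.
Proof. exact: measurable_standard_part. Qed.

HB.instance Definition _ := isMeasurableFun.Build _ _ _ _ st mst.

Definition limit_plan : probability (borel (geodesic X)) R := distribution L st.

HB.instance Definition _ :=
  isMeasurableFun.Build _ _ _ _ (@endpoints R X) (@measurable_endpoints R X).

Let z01 : 0%R \in `[0%R : R, 1%R]. Proof. by rewrite in_itv/= lexx ler01. Qed.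
Let o01 : 1%R \in `[0%R : R, 1%R]. Proof. by rewrite in_itv/= lexx ler01. Qed.

(** The event is covered by the internal events that the endpoints are sent
near K1 and K2, whose Pi_i-masses are products because Pi_i is a plan. *)
Lemma limit_endpoints_closed (K1 K2 : set X) : closed K1 -> closed K2 ->
  distribution limit_plan (@endpoints R X) (K1 `*` K2)
    <= normalized_ball nu x r K1 * normalized_ball nu x r K2.
Proof.
move=> cK1 cK2; set mu := normalized_ball nu x r.
have mK1 := measurable_closed_borel cK1; have mK2 := measurable_closed_borel cK2.
have f1 : mu K1 \is a fin_num by rewrite fin_num_measure.
have f2 : mu K2 \is a fin_num by rewrite fin_num_measure.
apply/lee_addgt0Pr => e e0.
(* since mu K1 and mu K2 are at most 1, the product of the two bounds exceeds
   mu K1 * mu K2 by at most 3 * d *)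
pose d := (Num.min e 1 / 3)%R.
have d0 : (0 < d)%R by rewrite divr_gt0// lt_min e0 ltr01.
have d1 : (d <= 1 / 3)%R by rewrite ler_pM2r// ge_min lexx orbT.
have de : (d <= e / 3)%R by rewrite ler_pM2r// ge_min lexx.
apply: (@le_trans _ _ ((mu K1 + d%:E) * (mu K2 + d%:E))); last first.
  have : mu K1 <= 1 by exact: probability_le1.
  have : mu K2 <= 1 by exact: probability_le1.
  have : 0 <= mu K1 by [].
  have : 0 <= mu K2 by [].
  rewrite -(fineK f1) -(fineK f2).
  rewrite -2!EFinD -2!EFinM -EFinD !lee_fin.
  set p := fine (mu K1); set q := fine (mu K2) => q0 p0 q1 p1.
  have h1 : (p * d <= 1 * d)%R by rewrite ler_wpM2r// ltW.
  have h2 : (d * q <= d * 1)%R by rewrite ler_wpM2l// ltW.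
  have h3 : (d * d <= d * 1)%R by rewrite ler_wpM2l ?ltW//; lra.
  by rewrite mulrDl !mulrDr; lra.
have [n1 h1] := normalized_ball_limsup cK1 d0.
have [n2 h2] := normalized_ball_limsup cK2 d0.
pose A i := passes_near f K1 n1.+1%:R^-1 0 i `&` passes_near f K2 n2.+1%:R^-1 1 i.
apply: (@L_le _ A).
- rewrite -[X in measurable X]setTI; apply: mst => //.
  rewrite -[X in measurable X]setTI; apply: measurable_endpoints => //.
  exact: measurableX.
- by move=> i; apply: measurableI; exact: measurable_passes_near.
- move=> m [K1m K2m].
  have i0 k : (0 < k.+1%:R^-1 :> R)%R by [].
  exact: filterI (standard_part_near (i0 n1) z01 K1m)
                 (standard_part_near (i0 n2) o01 K2m).
- apply: oo_sub; apply: filterS3 h1 h2 near_ball_gt0 => i h1 h2 Bi0.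
  have -> : Pi_ i (A i) = pushforward (Pi_ i) (@endpoints R (X_ i))
      ((f i @^-1` thickening K1 n1.+1%:R^-1) `*`
       (f i @^-1` thickening K2 n2.+1%:R^-1)).
    by congr (Pi_ i _); apply/seteqP; split => g [].
  rewrite plan//; last exact: measurableX.
  by rewrite product_measure1E//; apply: lee_pmul.
Qed.

Lemma limit_plan_democratic :
  dynamical_democratic_plan (normalized_ball nu x r) limit_plan.
Proof.
move=> A mA.
have H := rectangle_le_eq (closed_rectangle_le limit_endpoints_closed).
by rewrite (product_measure_unique H mA).
Qed.

(** One index i serves all the times t, because it only has to be good for the
finitely many nodes of a grid: geodesics move little between a node and the
times next to it, both in X and in X_i. *)
Lemma limit_time_le (K : set X) (n : nat) (e : R) : closed K -> (0 < e)%R ->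
  \forall i \near U, forall t : R, t \in `[0%R, 1%R] ->
    limit_plan (@eval_at R X t @^-1` K)
      <= Pi_ i (passes_near f K n.+1%:R^-1 t i) + e%:E.
Proof.
move=> cK e0; have [D D0 hD] := compact_diameter cX.
have mK := measurable_closed_borel cK.
have d0 : (0 < n.+1%:R^-1 :> R)%R by [].
set d : R := (n.+1%:R^-1)%R in d0 *.
have d40 : (0 < d / 4)%R by rewrite divr_gt0.
have D1 : (0 < D + 1)%R by lra.
(* D + 1 bounds the diameter of X_ i as soon as eps i < 1 *)
have [N Nd] := @ex_invS_lt _ (d / 4 / (D + 1))%R ltac:(by rewrite divr_gt0).
rewrite ltr_pdivlMr// in Nd.
have N0 : (0 < N.+1%:R^-1 :> R)%R by [].
pose S (j : nat) := st @^-1`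
  (@eval_at R X (j%:R / N.+1%:R)%R @^-1` thickening K (d / 4)%R).
have mS j : measurable (S j).
  rewrite -[X in measurable X]setTI; apply: mst => //.
  apply: measurable_eval_at_set; apply: measurable_open_borel.
  exact: open_thickening.
have grid (j : 'I_N.+2) : (j%:R / N.+1%:R)%R \in `[0%R : R, 1%R].
  by apply: grid01; rewrite -ltnS.
have mP (j : 'I_N.+2) i : measurable (passes_near f K (d / 2)%R (j%:R / N.+1%:R)%R i).
  exact: measurable_passes_near.
have step1 (j : 'I_N.+2) : \forall i \near U,
    L (S j) <= Pi_ i (passes_near f K (d / 2)%R (j%:R / N.+1%:R)%R i) + e%:E.
  have fS : L (S j) \is a fin_num by rewrite fin_num_measure.
  apply: contrapT => /(near_ultraNP FU) h.
  have : L (S j) <= (fine (L (S j)) - e)%:E.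
    apply: (@L_le _ (fun i => passes_near f K (d / 2)%R (j%:R / N.+1%:R)%R i)
      _ (mS j) (mP j)).
      move=> m /(@standard_part_near _ _ _ f _ _ FU oo_sub eps_cvg f_isom cX
        _ _ _ (w m) d40 (grid j)).
      apply: filterS => i [z Kz zi].
      have -> : (d / 2 = d / 4 + d / 4)%R by field.
      by apply: thickening_triangle Kz _; exact: ltW.
    apply: filterS h => i /negP; rewrite -ltNge.
    have f1 : Pi_ i (passes_near f K (d / 2)%R (j%:R / N.+1%:R)%R i) \is a fin_num.
      by rewrite fin_num_measure.
    by rewrite -(fineK f1) -(fineK fS) -EFinD lee_fin lte_fin /= => h; lra.
  by rewrite -{1}(fineK fS) lee_fin; lra.
have step2 := filter_forall (ultra_proper (UltraFilter := FU)) step1.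
have one0 : (0 < 1 :> R)%R by [].
apply: filterS3 step2 (near_eps oo_sub eps_cvg one0)
  (near_eps oo_sub eps_cvg d40).
move=> i hi e1 ed t t01.
have [j jN tj] := grid_approx N t01.
have {}hi := hi (Ordinal (jN : (j < N.+2)%N)); rewrite /= in hi.
have gj : (j%:R / N.+1%:R)%R \in `[0%R : R, 1%R] by exact: grid01.
apply: (@le_trans _ _ (L (S j))).
  have mKt : measurable (st @^-1` (@eval_at R X t @^-1` K)).
    rewrite -[X in measurable X]setTI; apply: mst => //.
    exact: measurable_eval_at_set.
  apply: (@le_trans _ _ (L (st @^-1` (@eval_at R X t @^-1` K)))) => //.
  apply: le_measure; rewrite ?inE//.
  move=> m Km; exists (eval_at t (st m)) => //.
  rewrite eval_at_dist//; apply: le_lt_trans Nd.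
  apply: ler_pM => //; first exact: mdist_ge0.
  by rewrite (le_trans (hD _ _))// lerDl.
apply: (le_trans hi); rewrite leeD2r//; apply: le_measure; rewrite ?inE.
- exact: (mP (Ordinal (jN : (j < N.+2)%N))).
- exact: measurable_passes_near.
move=> g Kg; rewrite /passes_near/=.
have -> : (d = d / 2 + d / 2)%R by field.
apply: thickening_triangle Kg _.
have := @f_isom i (eval_at (j%:R / N.+1%:R)%R g) (eval_at t g).
have := @f_isom i (eval_at 0 g) (eval_at 1 g).
rewrite (eval_at_dist g gj t01) !ler_norml => /andP[h1 _] /andP[_ h2].
have h3 := hD (f i (eval_at 0 g)) (f i (eval_at 1 g)).
move: e1 ed; rewrite !ltr_norml => /andP[_ e1] /andP[_ ed].
have h4 : (`|j%:R / N.+1%:R - t| * mdist (eval_at 0 g : X_ i) (eval_at 1 g)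
    <= N.+1%:R^-1 * (D + 1))%R.
  apply: ler_pM => //; [exact: mdist_ge0|by rewrite distrC|].
  by move: h1 h3 e1; set u := mdist _ _; set v := mdist _ _ => *; lra.
move: h2 h4 Nd ed; set u := mdist _ _; set v := (`|_| * _)%R.
set y := (_ * (D + 1))%R.
by move=> h2 h4 Nd ed; lra.
Qed.

Let time_measure (A : set (borel X)) : \bar R :=
  \int[lebesgue_measure]_(t in `[0%R, 1%R]) limit_plan (@eval_at R X t @^-1` A).

Let lebI : @lebesgue_measure R `[0%R, 1%R] = 1.
Proof. by rewrite lebesgue_measure_itv/= lte_fin ltr01 oppr0 adde0. Qed.

Let integral_cst01 (a : R) :
  \int[@lebesgue_measure R]_(t in `[0%R, 1%R]) a%:E = a%:E.
Proof.
rewrite -[RHS]mule1 integral_cst//; congr (_ * _); exact: lebI.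
Qed.

Lemma time_measure_le1 A : measurable A -> time_measure A <= 1.
Proof.
move=> mA; rewrite -(integral_cst01 1); apply: ge0_le_lower_integral => // t _.
by apply: probability_le1; exact: measurable_eval_at_set.
Qed.

(** DM(C) is applied on one X_i only, for an index i that is good for all
times by [limit_time_le]. *)
Lemma time_measure_closed (K : set X) : closed K ->
  time_measure K <= (C / c)%:E * nu K.
Proof.
move=> cK; have mK := measurable_closed_borel cK.
have fK : nu K \is a fin_num by rewrite fin_num_measure.
have T0 : 0 <= time_measure K by exact: integral_ge0.
have fT : time_measure K \is a fin_num.
  by rewrite ge0_fin_numE// (le_lt_trans (time_measure_le1 mK))// ltry.
rewrite -(fineK fT) -(fineK fK) -EFinM lee_fin.
apply: le_ratio_of_approx => //; [exact: fine_ge0|exact: fine_ge0|].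
move=> e e0 ec.
have [n h] := thickening_limsup nu_cvg cK e0.
have [i [[[hT hK] Bi0] hB]] := filter_ex (filterI (filterI (filterI
  (limit_time_le n cK e0) (oo_sub h)) (oo_sub near_ball_gt0))
  (oo_sub (ball_liminf eps_cvg f_isom nu_cvg r x_cvg e0))).
have mBi := measurable_mball (x_ i) r.
have fBi : nu_ i (ball (x_ i) r) \is a fin_num by rewrite fin_num_measure.
have fKi : nu_ i (f i @^-1` thickening K n.+1%:R^-1) \is a fin_num.
  by rewrite fin_num_measure.
(* t |-> limit_plan (e_t in K) is measurable, so e can be split off from its
   integral; truncating at 0 leaves a nonnegative function, whose integral
   compares with the lower integral bounded by DM(C) on X_ i *)
pose g (t : R) := maxe (limit_plan (@eval_at R X t @^-1` K) - e%:E) 0.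
have mgT : measurable_fun [set: R] g.
  apply: measurable_maxe => //; apply: emeasurable_funB => //.
  exact: measurable_prob_eval_closed.
have le1 : time_measure K <=
    \int[lebesgue_measure]_(t in `[0%R, 1%R]) g t + e%:E.
  rewrite -(integral_cst01 e) -ge0_integralD//; last 3 first.
  - by move=> t _; rewrite /g le_max lexx orbT.
  - exact: measurable_funTS.
  - by move=> t _; rewrite lee_fin ltW.
  apply: ge0_le_lower_integral => // t _.
  by rewrite -leeBlDr// /g le_max lexx.
have le2 : \int[lebesgue_measure]_(t in `[0%R, 1%R]) g t <=
    (C / fine (nu_ i (ball (x_ i) r)))%:E *
    nu_ i (f i @^-1` thickening K n.+1%:R^-1).
  apply: le_trans (bound Bi0 (@mthick i n K)).
  apply: ge0_le_lower_integral => t t01; first by rewrite /g le_max lexx orbT.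
  rewrite /g ge_max; apply/andP; split; last exact: (measure_ge0 (Pi_ i)).
  by rewrite leeBlDr//; exact: hT.
have := le_trans le1 (leeD2r _ le2).
rewrite -(fineK fT) -(fineK fKi) -EFinM -EFinD lee_fin.
move: hK hB; rewrite fB -(fineK fBi) -(fineK fKi) -(fineK fK) -!EFinD !lee_fin.
have : (0 <= fine (nu K))%R by exact: fine_ge0.
rewrite (fineK fBi).
set I := fine (time_measure K); set k := fine (nu K).
set b := fine (nu_ i (ball _ _)); set k' := fine (nu_ i _) => k0 hk hb hI.
have b0 : (0 < b)%R by lra.
have {}hI : ((I - e) * b <= C * (k + e))%R.
  rewrite -ler_pdivlMr// mulrAC lerBlDr (le_trans hI)// lerD2r.
  by rewrite ler_wpM2l// divr_ge0// ltW.
have [I0|I0] := leP 0%R (I - e)%R.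
  by apply: le_trans hI; rewrite ler_wpM2l// lerBlDr.
apply: (@le_trans _ _ 0%R); last first.
  by rewrite mulr_ge0// ?addr_ge0// ltW.
by rewrite nmulr_rle0// subr_ge0 ltW.
Qed.

(** Monotone convergence along closed subsets increasing to V. *)
Lemma time_measure_open (V : set X) : open V ->
  time_measure V <= (C / c)%:E * nu V.
Proof.
move=> oV; have mV := measurable_open_borel oV.
have cV : closed (~` V) by exact: open_closedC.
(* V is the increasing union of these closed sets *)
pose K n := ~` thickening (~` V) n.+1%:R^-1.
have cK n : closed (K n) by apply: open_closedC; exact: open_thickening.
have mK n := measurable_closed_borel (cK n).
have KV n : K n `<=` V.
  by rewrite -[X in _ `<=` X]setCK; apply: subsetC; exact: sub_thickening.
have ndK m n : (m <= n)%N -> K m `<=` K n.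
  by move=> mn; apply: subsetC; exact: thickening_decr.
have UK : \bigcup_n K n = V.
  by rewrite -setC_bigcap (bigcap_thickening cV) setCK.
have -> : time_measure V = limn (fun n => time_measure (K n)).
  rewrite /time_measure -monotone_convergence//.
  - apply: eq_integral => t _; apply/esym/cvg_lim => //.
    have -> : @eval_at R X t @^-1` V = \bigcup_n (@eval_at R X t @^-1` K n).
      by rewrite -preimage_bigcup UK.
    apply: nondecreasing_cvg_mu => //.
    + by move=> n; exact: measurable_eval_at_set.
    + by apply: bigcup_measurable => n _; exact: measurable_eval_at_set.
    + by move=> m n mn; apply/subsetPset; apply: preimage_subset; exact: ndK.
  - by move=> n; apply: measurable_funTS; exact: measurable_prob_eval_closed.
  - move=> t _ m n mn; apply: le_measure; rewrite ?inE;
      [exact: measurable_eval_at_set|exact: measurable_eval_at_set|].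
    by apply: preimage_subset; exact: ndK.
apply: lime_le.
  apply: ereal_nondecreasing_is_cvgn => m n mn.
  apply: ge0_le_lower_integral => // t _.
  apply: le_measure; rewrite ?inE;
    [exact: measurable_eval_at_set|exact: measurable_eval_at_set|].
  by apply: preimage_subset; exact: ndK.
apply: nearW => n; apply: (le_trans (time_measure_closed (cK n))).
apply: lee_wpmul2l; first by rewrite lee_fin divr_ge0// ltW.
by apply: le_measure; rewrite ?inE//; exact: KV.
Qed.

(** Outer regularity of nu. *)
Lemma limit_plan_bound (A : set (borel X)) : measurable A ->
  \int[lebesgue_measure]_(t in `[0%R, 1%R])
     pushforward limit_plan (@eval_at R X t) A <= (C / c)%:E * nu A.
Proof.
move=> mA; have Cc0 : (0 < C / c)%R by rewrite divr_gt0.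
apply/lee_addgt0Pr => e e0.
have d0 : (0 < e / (C / c))%R by rewrite divr_gt0.
have [V [oV AV hV]] := borel_outer_regular nu mA d0.
have mV := measurable_open_borel oV.
apply: (@le_trans _ _ (time_measure V)).
  apply: ge0_le_lower_integral => t _; first exact: (measure_ge0 limit_plan).
  apply: (@le_measure _ _ _ limit_plan); rewrite ?inE;
    [exact: measurable_eval_at_set|exact: measurable_eval_at_set|].
  exact: preimage_subset.
apply: (le_trans (time_measure_open oV)).
apply: (@le_trans _ _ ((C / c)%:E * (nu A + (e / (C / c))%:E))).
  by apply: lee_wpmul2l => //; rewrite lee_fin ltW.
have fA : nu A \is a fin_num by rewrite fin_num_measure.
rewrite -(fineK fA) -EFinD -!EFinM -EFinD lee_fin mulrDr mulrCA divff ?mulr1//.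
by rewrite gt_eqF.
Qed.

End limit_plan.

Theorem theorem1p8 (R : realType) (C : R)
    (X_ : nat -> pmetricType R) (nu_ : forall i, probability (borel (X_ i)) R)
    (X : pmetricType R) (nu : probability (borel X) R) :
  0 < C ->
  (forall i, compact_length_space (X_ i)) ->
  compact_length_space X ->
  mGH_cvg nu_ nu ->
  (forall (x : X) (r : R), 0 < r -> nu (ball x r) = nu (closure (ball x r))) ->
  (forall i, DM C (nu_ i)) ->
  DM C nu.
Proof.
move=> C0 _ [cX lX] [f [eps [[eps0 eps_cvg] f_isom f_dense nu_cvg]]] nuB dm.
move=> x r r0 B0.
have [U [FU oo_sub]] := ultraFilterLemma eventually_filter.
pose x_ i := projT1 (cid (f_dense x i)).
have x_cvg i : mdist (f i (x_ i) : X) x <= eps i := projT2 (cid (f_dense x i)).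
have nuBx := nuB x r r0.
have hPi i : exists Pi : probability (borel (geodesic (X_ i))) R,
    (0 < nu_ i (ball (x_ i) r))%E ->
    dynamical_democratic_plan (normalized_ball (nu_ i) (x_ i) r) Pi /\
    forall A : set (borel (X_ i)), measurable A ->
      (\int[lebesgue_measure]_(t in `[0%R, 1%R])
         pushforward Pi (@eval_at R (X_ i) t) A
      <= (C / fine (nu_ i (ball (x_ i) r)))%:E * nu_ i A)%E.
  have [Bi0|nBi0] := pselect (0 < nu_ i (ball (x_ i) r))%E.
    by have [Pi hPi] := dm i (x_ i) r r0 Bi0; exists Pi.
  (* only finitely many of the balls have mass 0 *)
  by exists (dirac point).
pose Pi_ i := projT1 (cid (hPi i)).
have [disp [M [L [w [mw L_le]]]]] := loeb_probability Pi_ FU.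
have plan i Bi0 := (projT2 (cid (hPi i)) Bi0).1.
have bound i Bi0 := (projT2 (cid (hPi i)) Bi0).2.
exists (limit_plan cX eps_cvg f_isom FU oo_sub L mw); split.
  exact: (limit_plan_democratic cX lX eps_cvg f_isom nu_cvg r0 x_cvg nuBx B0
    FU oo_sub plan mw L_le).
move=> A mA.
exact: (limit_plan_bound C0 cX eps_cvg f_isom nu_cvg x_cvg B0 FU oo_sub
  bound mw L_le mA).
Qed.
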